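(* Let $\mathfrak{g}=\mathfrak{sl}_2(\mathbb{C})\ltimes V_7$ and let $k\ge 0$. Then $$H^k(\mathfrak{g},\mathfrak{g})\cong\begin{cases}\mathbb{C}, & \text{if } k=1,3,4,5,6,7,8,10,\\ 0, & \text{otherwise.}\end{cases}$$
   Context: $V_m$ denotes the irreducible $\mathfrak{sl}_2(\mathbb{C})$-module of dimension $m+1$. The semidirect product $\mathfrak{sl}_2(\mathbb{C})\ltimes V_m$ is the vector space $\mathfrak{sl}_2(\mathbb{C})\oplus V_m$ with Lie bracket $[(X,v),(Y,u)]=([X,Y],Xu-Yv)$. $H^k(\mathfrak{g},\mathfrak{g})$ denotes the $k$-th Lie algebra (Chevalley–Eilenberg) cohomology of $\mathfrak{g}$ with coefficients in the adjoint module. *)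

(* Defs.v *)
From HB Require Import structures.
From mathcomp Require Import all_boot all_order all_algebra.
From mathcomp Require Export complex.
From mathcomp Require Import boolp functions.
From mathcomp Require Export reals.

Set Implicit Arguments.
Unset Strict Implicit.
Unset Printing Implicit Defensive.

Import GRing.Theory.
Local Open Scope ring_scope.
Local Open Scope quotient_scope.

HB.mixin Record Lmodule_isLie (F : fieldType) g of GRing.Lmodule F g := {
  lie : g -> g -> g;
  lie_linearl : forall y : g, linear (lie^~ y);
  lie_linearr : forall x : g, linear (lie x);
  liexx : forall x, lie x x = 0;
  lie_jacobi : forall x y z,
    lie x (lie y z) + lie y (lie z x) + lie z (lie x y) = 0
}.

#[short(type="lieAlgType")]
HB.structure Definition LieAlgebra (F : fieldType) :=
  {g of GRing.Lmodule F g & Lmodule_isLie F g}.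

Lemma lieC (F : fieldType) (g : lieAlgType F) (x y : g) :
  lie x y = - lie y x.
Proof.
have lieDl (a b c : g) : lie (a + b) c = lie a c + lie b c.
  by have := lie_linearl c 1 a b; rewrite !scale1r.
have lieDr (a b c : g) : lie a (b + c) = lie a b + lie a c.
  by have := lie_linearr a 1 b c; rewrite !scale1r.
apply/eqP; rewrite -addr_eq0; apply/eqP.
by have := liexx (x + y); rewrite lieDl !lieDr !liexx add0r addr0.
Qed.

Lemma jacobi_cancel (V : zmodType) (a b c d e f : V) :
  (a - b - (c - f)) + (c - d - (e - b)) + (e - f - (a - d)) = 0.
Proof.
have h (p q r s : V) : p - q - (r - s) = (p + s) - (q + r).
  by rewrite opprB addrACA opprD.
have t (p q r : V) : p - q + (q - r) = p - r by rewrite addrA subrK.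
by rewrite !h (addrC c b) (addrC e d) (addrC f a) !t subrr.
Qed.

Section Representations.
Variables (F : fieldType) (g : lieAlgType F).

Record lieRep (M : lmodType F) := LieRep {
  rep_act :> g -> M -> M;
  rep_linearl : forall m : M, linear (rep_act^~ m);
  rep_linearr : forall x : g, linear (rep_act x);
  rep_lie : forall x y m,
    rep_act (lie x y) m = rep_act x (rep_act y m) - rep_act y (rep_act x m)
}.

Definition irreducible_rep (V : vectType F) (rho : lieRep V) : Prop :=
  (fullv : {vspace V}) <> 0%VS /\
  forall U : {vspace V}, (forall x v, v \in U -> rho x v \in U) ->
    U = 0%VS \/ U = fullv.

Lemma adjoint_lie (x y m : g) :
  lie (lie x y) m = lie x (lie y m) - lie y (lie x m).
Proof.
have lierN (a b : g) : lie a (- b) = - lie a b.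
  by have := lie_linearr a (-1) b 0;
     rewrite !addr0 !scaleN1r => ->; have := lie_linearr a (-1) b b;
     rewrite scaleN1r addNr scaleN1r addNr => ->; rewrite addr0.
have /eqP := lie_jacobi x y m.
by rewrite (lieC m x) lierN (lieC m) addr_eq0 opprK => /eqP ->.
Qed.

Definition adjoint : lieRep g :=
  LieRep (@lie_linearl F g) (@lie_linearr F g) adjoint_lie.

End Representations.

Section SemidirectProduct.
Variables (F : fieldType) (g : lieAlgType F) (M : lmodType F).
Variable rho : lieRep g M.

(* The parameter [rho] is a phantom: it selects the bracket. *)
Definition semidirect of lieRep g M : Type := (g * M)%type.
Local Notation gM := (semidirect rho).

HB.instance Definition _ := GRing.Lmodule.copy gM (g * M)%type.

Definition semidirect_lie (x y : gM) : gM :=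
  (lie x.1 y.1, rho x.1 y.2 - rho y.1 x.2).

Lemma semidirect_lie_linearl y : linear (semidirect_lie^~ y).
Proof.
move=> a x z; rewrite /semidirect_lie; congr pair => /=.
  exact: lie_linearl.
by rewrite rep_linearl rep_linearr scalerBr opprD addrACA.
Qed.

Lemma semidirect_lie_linearr x : linear (semidirect_lie x).
Proof.
move=> a y z; rewrite /semidirect_lie; congr pair => /=.
  exact: lie_linearr.
by rewrite rep_linearl rep_linearr scalerBr opprD addrACA.
Qed.

Lemma semidirect_liexx x : semidirect_lie x x = 0.
Proof. by rewrite /semidirect_lie liexx subrr. Qed.

Lemma semidirect_lie_jacobi x y z :
  semidirect_lie x (semidirect_lie y z) + semidirect_lie y (semidirect_lie z x)
  + semidirect_lie z (semidirect_lie x y) = 0.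
Proof.
have rhoB a u v : rho a (u - v) = rho a u - rho a v.
  by rewrite addrC -scaleN1r rep_linearr scaleN1r addrC.
rewrite /semidirect_lie; congr pair => /=; first exact: lie_jacobi.
rewrite !rhoB !rep_lie.
exact: jacobi_cancel.
Qed.

HB.instance Definition _ := Lmodule_isLie.Build F gM
  semidirect_lie_linearl semidirect_lie_linearr
  semidirect_liexx semidirect_lie_jacobi.

End SemidirectProduct.

Section Sl2.
Variable F : fieldType.

Definition traceless : pred 'M[F]_2 := [pred A | \tr A == 0].

Lemma traceless_submod_closed : submod_closed traceless.
Proof.
split=> [|a A B]; rewrite !inE ?mxtrace0 // => /eqP tA /eqP tB.
by rewrite mxtraceD mxtraceZ tA tB mulr0 addr0.
Qed.

HB.instance Definition _ :=
  GRing.isSubmodClosed.Build F 'M[F]_2 traceless traceless_submod_closed.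

Record sl2 := Sl2 { sl2_val :> 'M[F]_2; sl2P : sl2_val \in traceless }.

HB.instance Definition _ := [isSub for sl2_val].
HB.instance Definition _ := [Choice of sl2 by <:].
HB.instance Definition _ := [SubChoice_isSubLmodule of sl2 by <:].

Lemma sl2_lie_traceless (A B : sl2) : A *m B - B *m A \in traceless.
Proof. by rewrite inE linearB /= mxtrace_mulC subrr. Qed.

Definition sl2_lie (A B : sl2) : sl2 := Sl2 (sl2_lie_traceless A B).

Lemma sl2_lie_linearl B : linear (sl2_lie^~ B).
Proof.
move=> a A C; apply: val_inj; rewrite /= mulmxDl mulmxDr.
by rewrite -scalemxAl -scalemxAr scalerBr opprD addrACA.
Qed.

Lemma sl2_lie_linearr A : linear (sl2_lie A).
Proof.
move=> a B C; apply: val_inj; rewrite /= mulmxDl mulmxDr.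
by rewrite -scalemxAl -scalemxAr scalerBr opprD addrACA.
Qed.

Lemma sl2_liexx A : sl2_lie A A = 0.
Proof. by apply: val_inj; rewrite /= subrr. Qed.

Lemma sl2_lie_jacobi A B C :
  sl2_lie A (sl2_lie B C) + sl2_lie B (sl2_lie C A) + sl2_lie C (sl2_lie A B)
  = 0.
Proof.
apply: val_inj; rewrite /= !mulmxBl !mulmxBr !mulmxA.
exact: jacobi_cancel.
Qed.

HB.instance Definition _ := Lmodule_isLie.Build F sl2
  sl2_lie_linearl sl2_lie_linearr sl2_liexx sl2_lie_jacobi.

End Sl2.

Section QuotientModule.
Variables (F : fieldType) (V : lmodType F) (I : submodClosed V).

(* [submodClosed] does not inherit from [zmodClosed], which [Quotient.quot]
   expects. *)
Definition in_submod : {pred V} := [pred v | v \in I].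

Lemma in_submod_zmod_closed : zmod_closed in_submod.
Proof.
split=> [|u v uI vI]; first exact: (rpred0 I).
by rewrite inE -scaleN1r (rpredD uI) // rpredZ.
Qed.

HB.instance Definition _ :=
  GRing.isZmodClosed.Build V in_submod in_submod_zmod_closed.

Definition quot_mod : Type := @Quotient.quot V in_submod.

HB.instance Definition _ := GRing.Zmodule.on quot_mod.
HB.instance Definition _ := EqQuotient.on quot_mod.

Definition quot_scale (a : F) (x : quot_mod) : quot_mod :=
  \pi_quot_mod (a *: repr x).

Lemma pi_quotD (u v : V) :
  \pi_quot_mod (u + v) = \pi_quot_mod u + \pi_quot_mod v.
Proof. exact: Quotient.pi_add. Qed.

Lemma pi_quotZ (a : F) (u : V) :
  \pi_quot_mod (a *: u) = quot_scale a (\pi_quot_mod u).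
Proof.
rewrite /quot_scale; set w := repr _.
have wu : u - w \in (in_submod : {pred V}).
  rewrite (Quotient.idealrBE in_submod) /w.
  by apply/eqP; exact: (esym (@reprK _ quot_mod (\pi_quot_mod u))).
apply/eqP; rewrite -(Quotient.idealrBE in_submod) -scalerBr.
by move: wu; rewrite !inE => /rpredZ.
Qed.

Lemma quot_scaleA (a b : F) (x : quot_mod) :
  quot_scale a (quot_scale b x) = quot_scale (a * b) x.
Proof.
elim/quotW: x => u.
by rewrite -(pi_quotZ b u) -(pi_quotZ a (b *: u)) -(pi_quotZ _ u) scalerA.
Qed.

Lemma quot_scale1 : left_id 1 quot_scale.
Proof. by elim/quotW=> u; rewrite -(pi_quotZ 1 u) scale1r. Qed.

Lemma quot_scaleDr : right_distributive quot_scale +%R.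
Proof.
move=> a; elim/quotW=> u; elim/quotW=> v.
rewrite -(pi_quotD u v) -(pi_quotZ a (u + v)) -(pi_quotZ a u) -(pi_quotZ a v).
by rewrite scalerDr; exact: pi_quotD.
Qed.

Lemma quot_scaleDl (x : quot_mod) : {morph quot_scale^~ x : a b / a + b}.
Proof.
elim/quotW: x => u a b.
rewrite -(pi_quotZ (a + b) u) -(pi_quotZ a u) -(pi_quotZ b u) scalerDl.
exact: pi_quotD.
Qed.

HB.instance Definition _ := GRing.Zmodule_isLmodule.Build F quot_mod
  quot_scaleA quot_scale1 quot_scaleDr quot_scaleDl.

End QuotientModule.

Section Cohomology.
Variables (F : fieldType) (g : lieAlgType F) (M : lmodType F).
Variable rho : lieRep g M.

Definition set_arg k (x : 'I_k -> g) (i : 'I_k) (y : g) : 'I_k -> g :=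
  fun j => if j == i then y else x j.

Definition multilinear k (f : ('I_k -> g) -> M) : Prop :=
  forall (x : 'I_k -> g) (i : 'I_k), linear (fun y => f (set_arg x i y)).

Definition alternating k (f : ('I_k -> g) -> M) : Prop :=
  forall (x : 'I_k -> g) (i j : 'I_k), i != j -> x i = x j -> f x = 0.

Definition is_cochain k : pred (('I_k -> g) -> M) :=
  [pred f | `[< multilinear f /\ alternating f >]].

Lemma is_cochain_submod_closed k : submod_closed (@is_cochain k).
Proof.
split=> [|a f f']; rewrite !inE.
  by apply/asboolP; split=> [x i b y z|//]; rewrite [LHS]/= scaler0 addr0.
move=> /asboolP[fl fa] /asboolP[fl' fa']; apply/asboolP; split.
  move=> x i b y z; rewrite -![(a *: f + f') _]/(a *: f _ + f' _) fl fl'.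
  by rewrite !scalerDr addrACA !scalerA mulrC.
move=> x i j ij xij; rewrite -[LHS]/(a *: f _ + f' _).
by rewrite (fa x i j) // (fa' x i j) // scaler0 addr0.
Qed.

HB.instance Definition _ k := GRing.isSubmodClosed.Build F _ (@is_cochain k)
  (@is_cochain_submod_closed k).

Record cochain k := Cochain {
  cochain_val :> ('I_k -> g) -> M;
  cochainP : cochain_val \in @is_cochain k
}.

HB.instance Definition _ k := [isSub for @cochain_val k].
HB.instance Definition _ k := [Choice of cochain k by <:].
HB.instance Definition _ k := [SubChoice_isSubLmodule of cochain k by <:].

(* Removing the indices [i < j] and putting [x_i, x_j] in front:
   [bump i] skips [i], then [bump j] skips [j]. *)
Definition bracket_args k (x : 'I_k.+1 -> g) (i j : 'I_k.+1) : 'I_k -> g :=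
  fun m => if m : nat is m'.+1 then x (inord (bump j (bump i m')))
           else lie (x i) (x j).

(* Since both indices start at 0, the signs are (-1)^i in the first sum and
   (-1)^(i+j) in the second one. *)
Definition ce_diff k (f : ('I_k -> g) -> M) (x : 'I_k.+1 -> g) : M :=
  \sum_(i < k.+1) (-1) ^+ i *: rho (x i) (f (fun m => x (lift i m)))
  + \sum_(i < k.+1) \sum_(j < k.+1 | (i < j)%N)
      (-1) ^+ (i + j) *: f (bracket_args x i j).

Lemma ce_diff_linear k : linear (@ce_diff k).
Proof.
move=> a f f'; apply/funext => x.
rewrite -[RHS]/(a *: ce_diff f x + ce_diff f' x) /ce_diff.
rewrite scalerDr addrACA; congr (_ + _).
  rewrite scaler_sumr -big_split; apply: eq_bigr => i _ /=.
  rewrite -[X in rho _ X]/(a *: f _ + f' _).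
  by rewrite rep_linearr scalerDr !scalerA mulrC.
rewrite scaler_sumr -big_split; apply: eq_bigr => i _ /=.
rewrite scaler_sumr -big_split; apply: eq_bigr => j _ /=.
rewrite -[X in _ *: X]/(a *: f _ + f' _).
by rewrite scalerDr !scalerA mulrC.
Qed.

HB.instance Definition _ k :=
  GRing.isLinear.Build F _ _ _ (@ce_diff k) (@ce_diff_linear k).

Definition is_cocycle k : pred (cochain k) :=
  [pred f : cochain k | ce_diff f == 0].

Lemma is_cocycle_submod_closed k : submod_closed (@is_cocycle k).
Proof.
split=> [|a f f']; rewrite !inE ?linear0 // => /eqP fc /eqP fc'.
by rewrite linearP /= fc fc' scaler0 addr0.
Qed.

HB.instance Definition _ k := GRing.isSubmodClosed.Build F _ (@is_cocycle k)
  (@is_cocycle_submod_closed k).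

Record cocycle k := Cocycle {
  cocycle_val :> cochain k;
  cocycleP : cocycle_val \in @is_cocycle k
}.

HB.instance Definition _ k := [isSub for @cocycle_val k].
HB.instance Definition _ k := [Choice of cocycle k by <:].
HB.instance Definition _ k := [SubChoice_isSubLmodule of cocycle k by <:].

(* Mathematically [ce_diff] maps cochains to cocycles, so restricting to
   cocycles [z] loses no [ce_diff f]. *)
Definition is_coboundary k : {pred cocycle k} :=
  match k with
  | 0 => [pred z | z == 0]
  | k'.+1 => [pred z : cocycle k'.+1 |
      `[< exists f : cochain k', z = ce_diff f :> (_ -> M) >]]
  end.

Lemma is_coboundary_submod_closed k : submod_closed (@is_coboundary k).
Proof.
case: k => [|k]; split=> [|a z z']; rewrite !inE.
- by [].
- by move=> /eqP-> /eqP->; rewrite scaler0 addr0.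
- by apply/asboolP; exists 0; rewrite linear0.
move=> /asboolP[f zf] /asboolP[f' zf']; apply/asboolP; exists (a *: f + f').
by rewrite !linearP /= zf zf'.
Qed.

HB.instance Definition _ k := GRing.isSubmodClosed.Build F _ (@is_coboundary k)
  (@is_coboundary_submod_closed k).

Definition cohomology k : lmodType F := quot_mod (@is_coboundary k).

End Cohomology.

Definition lmod_iso (F : fieldType) (U V : lmodType F) : Prop :=
  exists f : {linear U -> V}, bijective f.

(* Main.v *)
From HB Require Import structures.
Require Import Defs.
From mathcomp Require Import all_boot all_order all_algebra.
From mathcomp Require Import boolp functions reals complex.
From mathcomp Require Import zify ring spectral.

Set Implicit Arguments.
Unset Strict Implicit.
Unset Printing Implicit Defensive.

Import Order.TTheory GRing.Theory Num.Theory.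
Local Open Scope ring_scope.

(** Write [s] for [sl2], [V] for its irreducible module of dimension 8 and [g]
    for the semidirect product.

    The algebra [s] acts on the cochains C^k(g, g) in two commuting ways:
    [theta] moves the arguments lying in [V] and the values, and [alpha] moves
    the arguments lying in [s]. Their sum is the Lie derivative. The Casimir
    operators of [theta] and of the Lie derivative are both null-homotopic
    ([ced_htheta], [ced_hlie]); the first fact says that the cohomology of [s]
    with values in C(V, g) only sees the invariants of C(V, g), the second one
    is Cartan's homotopy formula. A weight argument ([casimir2_ker]) shows that
    each Casimir operator splits the space of cochains into its kernel, which
    consists of invariants, and its image. Hence every cocycle is cohomologous
    to one that is invariant under both actions, and a coboundary of this kind
    bounds a cochain of this kind ([two_step_dim]).

    Let J^k be the space of cochains invariant under [theta] and [alpha]. It is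
    the space of invariants of [s x s] in a finite-dimensional module, so that
    its dimension is the alternating sum m(0,0) - m(2,0) - m(0,2) + m(2,2) of
    weight multiplicities ([invariant_count]). These multiplicities are found by
    listing the weights of a basis of the cochains ([weight_count_table]): J^k
    is a line for k = 1, 3, 4, 5, 6, 7, 8, 10 and vanishes otherwise.

    The differential vanishes on J^k. Indeed the derivation of [g] which is 0 on
    [s] and 1 on [V] acts on the whole complex; the same count, refined by the
    eigenvalues of this Euler derivation, shows that it is a scalar on each line
    J^k, and the scalars for J^k and J^(k+1) always differ
    ([ced_op_invariants]). So the cohomology in degree k is J^k. (In terms of
    representations, J^k is spanned by the product of an invariant of degree
    0 or 3 of the exterior algebra of the dual of [s] and of an invariant map
    from the exterior power of degree 1, 3, 5 or 7 of [V] to [V].)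

    Cochains are handled as multilinear alternating functions on lists. The
    differential is then defined by recursion through Cartan's formula, and the
    identities between operators are proved by induction on the degree, by
    comparing their commutators with interior products ([form_ind0]). The
    alternating-sum formula is recovered in [cedE]. Finite dimension enters
    through the values of a cochain on strictly decreasing lists of basis
    vectors ([Phi], [Psi]). *)

(** * Deciding identities in abelian groups *)

(** An identity between sums in an abelian group holds as soon as every atom
    has the same integer coefficient on both sides; [abel] reflects this. *)
Inductive zexp := ZVar of nat | ZZero | ZAdd of zexp & zexp | ZOpp of zexp.

Fixpoint zeval (V : zmodType) (env : seq V) (e : zexp) : V :=
  match e with
  | ZVar i => env`_i
  | ZZero => 0
  | ZAdd a b => zeval env a + zeval env b
  | ZOpp a => - zeval env a
  end.

Fixpoint zcoef (e : zexp) (i : nat) : int :=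
  match e with
  | ZVar j => (i == j)%:Z
  | ZZero => 0
  | ZAdd a b => zcoef a i + zcoef b i
  | ZOpp a => - zcoef a i
  end.

Lemma zevalE (V : zmodType) (env : seq V) (e : zexp) :
  zeval env e = \sum_(i < size env) env`_i *~ zcoef e i.
Proof.
elim: e => /= [j||a -> b ->|a ->].
- have [ltj|gej] := ltnP j (size env).
    rewrite (bigD1 (Ordinal ltj)) //= eqxx big1 ?addr0 // => i /negPf.
    by rewrite -val_eqE /= => ->.
  rewrite nth_default // big1 // => i _.
  by case: eqP => // ij; move: gej; rewrite -ij leqNgt ltn_ord.
- by rewrite big1 // => i _; rewrite mulr0z.
- by rewrite -big_split; apply: eq_bigr => i _; rewrite mulrzDr.
- by rewrite -sumrN; apply: eq_bigr => i _; rewrite mulrNz.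
Qed.

Lemma zeval_eq (V : zmodType) (env : seq V) (e1 e2 : zexp) :
  all (fun i => zcoef e1 i == zcoef e2 i) (iota 0 (size env)) ->
  zeval env e1 = zeval env e2.
Proof.
move=> /allP h; rewrite !zevalE; apply: eq_bigr => i _.
by congr (_ *~ _); apply/eqP/h; rewrite mem_iota ltn_ord.
Qed.

Ltac zindex x env :=
  lazymatch env with
  | nil => fail
  | ?y :: ?env' =>
    match constr:(Set) with
    | _ =>
      let _ := match constr:(Set) with
               | _ => first [constr_eq x y | unify x y]
               end in
      constr:(0%N)
    | _ => let n := zindex x env' in constr:(S n)
    end
  end.

Ltac zcollect e env :=
  lazymatch e with
  | (?a + ?b)%R => let env := zcollect a env in zcollect b env
  | (- ?a)%R => zcollect a env
  | 0%R => env
  | _ => match constr:(Set) with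
         | _ => let _ := zindex e env in env
         | _ => constr:(e :: env)
         end
  end.

Ltac zreify e env :=
  lazymatch e with
  | (?a + ?b)%R =>
    let a := zreify a env in let b := zreify b env in constr:(ZAdd a b)
  | (- ?a)%R => let a := zreify a env in constr:(ZOpp a)
  | 0%R => constr:(ZZero)
  | _ => let i := zindex e env in constr:(ZVar i)
  end.

Ltac abel :=
  lazymatch goal with
  | |- @eq ?V ?a ?b =>
    let env := zcollect a (@nil V) in
    let env := zcollect b env in
    let ra := zreify a env in
    let rb := zreify b env in
    apply: (@zeval_eq _ env ra rb); vm_compute; reflexivity
  end.

(** * Cartan calculus on forms *)

HB.instance Definition _ (F : fieldType) (g : lieAlgType F) (x : g) :=
  GRing.isLinear.Build F g g _ (lie x) (lie_linearr x).
HB.instance Definition _ (F : fieldType) (g : lieAlgType F) (M : lmodType F)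
    (rho : lieRep g M) (x : g) :=
  GRing.isLinear.Build F M M _ (rep_act rho x) (rep_linearr rho x).

Section Forms.
Variables (F : fieldType) (g M : lmodType F).
Implicit Types (f : seq g -> M) (s : seq g) (x y : g).

(** A form has no fixed degree: it is a family of alternating multilinear maps,
    one for each length. Asking that equal adjacent arguments give 0 is enough,
    and is stable under the recursive definitions below. *)
Definition form f : Prop :=
  (forall s1 s2, linear (fun x => f (s1 ++ x :: s2))) /\
  (forall s1 x s2, f (s1 ++ x :: x :: s2) = 0).

(** The interior product. *)
Definition ins x f : seq g -> M := fun s => f (x :: s).

Lemma ins_linear x : linear (ins x).
Proof. by []. Qed.

HB.instance Definition _ x :=
  GRing.isLinear.Build F _ _ _ (ins x) (ins_linear x).

(** The natural action of a pair of endomorphisms on alternating maps with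
    values in [M]: the sum over the arguments is unfolded one argument at a
    time, which makes [ins_act] definitional. *)
Fixpoint act (T : g -> g) (B : M -> M) f s : M :=
  if s is y :: s' then act T B (ins y f) s' - f (T y :: s') else B (f [::]).

Lemma act_linear (T : g -> g) (B : {linear M -> M}) : linear (act T B).
Proof.
move=> a f f'; apply/funext => s; elim: s f f' => [|y s IH] f f' /=.
  exact: linearP.
rewrite linearP IH !fctE /= scalerBr; abel.
Qed.

HB.instance Definition _ T (B : {linear M -> M}) :=
  GRing.isLinear.Build F _ _ _ (act T B) (act_linear T B).

Lemma ins_act T B y f : ins y (act T B f) = act T B (ins y f) - ins (T y) f.
Proof. by []. Qed.

Lemma act_ext (T T' : g -> g) (B B' : M -> M) f :
  T =1 T' -> B =1 B' -> act T B f = act T' B' f.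
Proof. by move=> /funext -> /funext ->. Qed.

Lemma form_consP a x y f s :
  form f -> f (a *: x + y :: s) = a *: f (x :: s) + f (y :: s).
Proof. by move=> [fl _]; exact: (fl [::]). Qed.

Lemma insP a x y f : form f -> ins (a *: x + y) f = a *: ins x f + ins y f.
Proof. by move=> [fl _]; apply/funext => s; exact: (fl [::] s). Qed.

Lemma insDl x y f : form f -> ins (x + y) f = ins x f + ins y f.
Proof. by move=> ff; rewrite -[x in LHS]scale1r insP // scale1r. Qed.

Lemma ins0l f : form f -> ins 0 f = 0.
Proof. by move=> /(insDl 0 0) /eqP; rewrite addr0 -subr_eq subrr => /eqP. Qed.

Lemma insZl a x f : form f -> ins (a *: x) f = a *: ins x f.
Proof. by move=> ff; rewrite -[X in ins X]addr0 insP // ins0l // addr0. Qed.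

Lemma insNl x f : form f -> ins (- x) f = - ins x f.
Proof. by move=> ff; rewrite -scaleN1r insZl // scaleN1r. Qed.

Lemma insBl x y f : form f -> ins (x - y) f = ins x f - ins y f.
Proof. by move=> ff; rewrite insDl // insNl. Qed.

Lemma form_ins x f : form f -> form (ins x f).
Proof.
by move=> [fl fa]; split=> [s1 s2|s1 y s2];
  [exact: (fl (x :: s1))|exact: (fa (x :: s1))].
Qed.

Lemma insxx x f : form f -> ins x (ins x f) = 0.
Proof. by move=> [_ fa]; apply/funext => s; exact: (fa [::]). Qed.

Lemma insC x y f : form f -> ins x (ins y f) = - ins y (ins x f).
Proof.
move=> ff; have := insxx (x + y) ff.
rewrite (insDl x y ff) linearD /= !(insDl x y (form_ins _ ff)).
rewrite !insxx // addr0 add0r => /eqP; rewrite addrC addr_eq0 => /eqP ->.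
by [].
Qed.

Lemma formP a f f' : form f -> form f' -> form (a *: f + f').
Proof.
move=> [fl fa] [fl' fa']; split=> [s1 s2 b x y|s1 x s2]; rewrite !fctE.
  rewrite fl fl' !scalerDr !scalerA (mulrC a b). abel.
by rewrite fa fa' scaler0 addr0.
Qed.

Lemma form0 : form 0.
Proof. by split=> [s1 s2 a x y|//]; rewrite /= scaler0 addr0. Qed.

Lemma formZ a f : form f -> form (a *: f).
Proof. by move=> ff; rewrite -[_ *: _]addr0; apply: formP => //; exact: form0. Qed.

Lemma formD f f' : form f -> form f' -> form (f + f').
Proof. by move=> ff ff'; rewrite -[f]scale1r; exact: formP. Qed.

Lemma formN f : form f -> form (- f).
Proof. by move=> ff; rewrite -scaleN1r; exact: formZ. Qed.

Lemma formB f f' : form f -> form f' -> form (f - f').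
Proof. by move=> ff /formN; exact: formD. Qed.

Lemma form_act (T : {linear g -> g}) (B : {linear M -> M}) f :
  form f -> form (act T B f).
Proof.
move=> ff; split=> [s1 s2|s1 x s2].
  elim: s1 f ff => [|y s1 IH] f ff a u v /=.
    rewrite insP // linearP /= linearP form_consP // !fctE scalerBr; abel.
  rewrite IH; last exact: form_ins.
  rewrite (ff.1 (T y :: s1)) scalerBr; abel.
elim: s1 f ff => [|y s1 IH] f ff /=.
  have E : f [:: T x, x & s2] = - f [:: x, T x & s2].
    by have := congr1 (fun u : seq g -> M => u s2) (insC x (T x) ff).
  by rewrite insxx // linear0 /ins E opprK subrK.
by rewrite IH ?sub0r; [rewrite (ff.2 (T y :: s1)) oppr0 | exact: form_ins].
Qed.

(** The principle behind all the operator identities: an operator that commutes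
    or anticommutes with the interior products and vanishes in degree 0 is
    zero. *)
Lemma form_ind0 (P : (seq g -> M) -> seq g -> M) (c : F) :
  (forall f, form f -> P f [::] = 0) ->
  (forall f y, form f -> ins y (P f) = c *: P (ins y f)) ->
  forall f, form f -> P f = 0.
Proof.
move=> P0 PS f ff; apply/funext => s; elim: s f ff => [|y s IH] f ff.
  exact: P0.
have -> : P f (y :: s) = c *: P (ins y f) s.
  by have := congr1 (fun u : seq g -> M => u s) (PS f y ff).
by rewrite IH ?scaler0 //; exact: form_ins.
Qed.

(** The commutator of [act T B] with [ins y] is [- ins (T y)], so both sides
    have the same commutators with interior products. *)
Lemma act_comm (T T' T'' : g -> g) (B B' : {linear M -> M}) (B'' : M -> M) f :
    (forall x, T'' x = T (T' x) - T' (T x)) ->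
    (forall m, B'' m = B (B' m) - B' (B m)) -> form f ->
  act T B (act T' B' f) - act T' B' (act T B f) = act T'' B'' f.
Proof.
move=> T''E B''E ff; apply/eqP; rewrite -subr_eq0; apply/eqP; move: f ff.
apply: (@form_ind0 _ 1) => [f ff|f y ff].
  by rewrite !fctE /= B''E subrr.
rewrite scale1r !(linearB (ins y)) /= !ins_act !linearB /= T''E insBl //.
abel.
Qed.

Lemma act_linearl a (T T' T'' : g -> g) (B B' B'' : M -> M) f :
    (forall x, T'' x = a *: T x + T' x) ->
    (forall m, B'' m = a *: B m + B' m) -> form f ->
  act T'' B'' f = a *: act T B f + act T' B' f.
Proof.
move=> T''E B''E ff; apply/eqP; rewrite -subr_eq0; apply/eqP; move: f ff.
apply: (@form_ind0 _ 1) => [f ff|f y ff].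
  by rewrite !fctE /= B''E subrr.
rewrite scale1r linearB /= [ins y (_ + _)]linearP /= !ins_act T''E insP //
  scalerBr; abel.
Qed.

Lemma act0 f : form f -> act (fun=> 0) (fun=> 0) f = 0.
Proof.
move: f; apply: (@form_ind0 _ 1) => // f y ff.
by rewrite ins_act ins0l // subr0 scale1r.
Qed.

End Forms.

Section ChevalleyEilenberg.
Variables (F : fieldType) (g : lieAlgType F) (M : lmodType F).
Variable rho : lieRep g M.
Implicit Types (f : seq g -> M) (x y : g).

(** The Lie derivative. *)
Definition lieder (x : g) := act (lie x) (rho x).

HB.instance Definition _ x := GRing.Linear.on (lieder x).

(** The Chevalley-Eilenberg differential, by recursion on the degree: the
    equation for a nonempty list is Cartan's formula. *)
Fixpoint ced f (s : seq g) : M :=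
  if s is x :: s' then lieder x f s' - ced (ins x f) s' else 0.

Lemma ced_linear : linear ced.
Proof.
move=> a f f'; apply/funext => s; elim: s f f' => [|y s IH] f f' /=.
  by rewrite !fctE scaler0 addr0.
rewrite !linearP /= IH !fctE /= scalerBr; abel.
Qed.

HB.instance Definition _ := GRing.isLinear.Build F _ _ _ ced ced_linear.

Lemma ins_ced x f : ins x (ced f) = lieder x f - ced (ins x f).
Proof. by []. Qed.

Lemma ins_lieder x y f :
  ins y (lieder x f) = lieder x (ins y f) - ins (lie x y) f.
Proof. by []. Qed.

Lemma form_lieder x f : form f -> form (lieder x f).
Proof. exact: form_act. Qed.

Lemma lieder_linearl f : form f -> linear (lieder^~ f).
Proof.
move=> ff a x y; apply/funext => s; elim: s f ff => [|z s IH] f ff; rewrite fctE.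
  exact: rep_linearl.
rewrite /lieder /= -![act _ _ _ _]/(lieder _ _ _) IH; last exact: form_ins.
rewrite lie_linearl form_consP // !fctE /= scalerBr; abel.
Qed.

Lemma form_ced f : form f -> form (ced f).
Proof.
move=> ff; split=> [s1 s2|s1 x s2].
  elim: s1 f ff => [|y s1 IH] f ff a u v /=.
    rewrite lieder_linearl // insP // linearP /= !fctE scalerBr; abel.
  rewrite IH; last exact: form_ins.
  rewrite (form_lieder y ff).1 scalerBr; abel.
elim: s1 f ff => [|y s1 IH] f ff /=.
  have -> : lieder x f (x :: s2) = lieder x (ins x f) s2.
    rewrite /lieder /= liexx -[f _]/(ins 0 f s2) ins0l //; exact: subr0.
  by rewrite insxx // linear0 opprB addrC subrK.
by rewrite IH ?subr0; [exact: (form_lieder y ff).2 | exact: form_ins].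
Qed.

(** Derivations act on the whole complex. Inner derivations give the Lie
    derivatives, and the Euler derivation gives a grading. *)
Lemma act_ced (T : {linear g -> g}) (B : {linear M -> M}) f :
    (forall x y, T (lie x y) = lie (T x) y + lie x (T y)) ->
    (forall x m, B (rho x m) = rho (T x) m + rho x (B m)) -> form f ->
  act T B (ced f) = ced (act T B f).
Proof.
move=> TD BD ff; apply/eqP; rewrite -subr_eq0; apply/eqP; move: f ff.
apply: (@form_ind0 _ _ _ _ (-1)) => [f ff|f y ff].
  by rewrite !fctE /= linear0 subrr.
have comm : act T B (lieder y f) - lieder y (act T B f) = lieder (T y) f.
  by apply: act_comm => // [x|m] /=; rewrite ?TD ?BD addrK.
rewrite scaleN1r linearB /= ins_act !ins_ced ins_act !linearB /= -comm.
rewrite !linearB /=; abel.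
Qed.

Lemma lieder_ced x f : form f -> lieder x (ced f) = ced (lieder x f).
Proof.
move=> ff; apply: act_ced => // [y z|y m]; rewrite /=.
  by rewrite adjoint_lie subrK.
by rewrite rep_lie subrK.
Qed.

Lemma lieder_comm x y f : form f ->
  lieder x (lieder y f) - lieder y (lieder x f) = lieder (lie x y) f.
Proof.
move=> ff; apply: act_comm => // [z|m] /=; first exact: adjoint_lie.
exact: rep_lie.
Qed.

(** By Cartan's formula the square of the differential commutes with interior
    products, because Lie derivatives commute with the differential. *)
Lemma ced_ced f : form f -> ced (ced f) = 0.
Proof.
move: f; apply: (@form_ind0 _ _ _ _ 1) => // f y ff.
rewrite scale1r ins_ced lieder_ced // ins_ced linearB /=; abel.
Qed.

End ChevalleyEilenberg.

(** * Cochains as forms *)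

Definition homog (g M : zmodType) k (f : seq g -> M) : Prop :=
  forall s, size s != k -> f s = 0.

Section Homogeneity.
Variables (F : fieldType) (g M : lmodType F).
Implicit Types (f : seq g -> M).

Lemma homog_ins k x f : homog k.+1 f -> homog k (ins x f).
Proof. by move=> hf s sk; apply: hf. Qed.

Lemma homog0_ins x f : homog 0 f -> ins x f = 0.
Proof. by move=> hf; apply/funext => s; apply: hf. Qed.

Lemma homog_act k T (B : {linear M -> M}) f : homog k f -> homog k (act T B f).
Proof.
move=> hf s; elim: s k f hf => [|y s IH] k f hf sk /=.
  by rewrite hf // linear0.
rewrite hf // subr0; case: k => [|k] in hf sk *.
  by rewrite homog0_ins // linear0.
by apply: (IH k); [exact: homog_ins|].
Qed.

End Homogeneity.

Lemma homog_ced (F : fieldType) (g : lieAlgType F) (M : lmodType F)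
    (rho : lieRep g M) k (f : seq g -> M) :
  homog k f -> homog k.+1 (ced rho f).
Proof.
move=> hf s; elim: s k f hf => [//|y s IH] k f hf sk /=.
have -> : lieder rho y f s = 0 by apply: homog_act hf _ _.
rewrite sub0r; case: k => [|k] in hf sk *.
  by rewrite homog0_ins // linear0 oppr0.
by rewrite (IH k) ?oppr0 //; exact: homog_ins.
Qed.

Section DelMove.

Definition del (T : Type) i (s : seq T) := take i s ++ drop i.+1 s.

Lemma nth_del (T : Type) x0 i (s : seq T) m :
  nth x0 (del i s) m = nth x0 s (bump i m).
Proof.
rewrite /del /bump; elim: i s m => [|i IH] [|y s] m;
  rewrite ?nth_nil //; case: m => [|m]; rewrite /= ?drop0 //.
by rewrite IH /= ltnS addnS.
Qed.

Lemma del0 (T : Type) (y : T) s : del 0 (y :: s) = s.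
Proof. by rewrite /del /= drop0. Qed.

Lemma delS (T : Type) i (y : T) s : del i.+1 (y :: s) = y :: del i s.
Proof. by []. Qed.

Variables (F : fieldType) (g M : lmodType F).
Implicit Types (f : seq g -> M).

(** Moving the modified argument to the front produces the signs of the
    classical formula for the differential. *)
Lemma act_move T (B : M -> M) f s : form f ->
  act T B f s = B (f s) - \sum_(j < size s) (-1) ^+ j *: f (T s`_j :: del j s).
Proof.
elim: s f => [|y s IH] f ff /=; first by rewrite big_ord0 subr0.
rewrite IH; last exact: form_ins.
rewrite big_ord_recl /= expr0 scale1r /del /= drop0 opprD addrA addrAC.
congr (_ - _ - _); apply: eq_bigr => j _.
rewrite exprS mulN1r scaleNr -scalerN; congr (_ *: _).
by have := congr1 (fun u : seq g -> M => u (del j s)) (insC (T s`_j) y ff).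
Qed.

Lemma form_dup f (s : seq g) : form f -> ~~ uniq s -> f s = 0.
Proof.
elim: s f => [//|y s IH] f ff /=; rewrite negb_and negbK.
have [|_] /= := boolP (y \in s); last by apply: IH (form_ins y ff).
case/splitPr => p1 p2 _; elim: p1 f ff {IH} => [|z p1 IH] f ff /=.
  exact: (ff.2 [::]).
have -> : f [:: y, z & p1 ++ y :: p2] = - ins z f (y :: p1 ++ y :: p2).
  by have := congr1 (fun u : seq g -> M => u (p1 ++ y :: p2)) (insC z y ff).
by rewrite IH ?oppr0 //; exact: form_ins.
Qed.

End DelMove.

Section CochainForms.
Variables (F : fieldType) (g : lieAlgType F) (M : lmodType F).
Variable rho : lieRep g M.

Definition to_form k (f : ('I_k -> g) -> M) (s : seq g) : M :=
  if size s == k then f (fun i => s`_i) else 0.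

Lemma homog_to_form k (f : ('I_k -> g) -> M) : homog k (to_form f).
Proof. by move=> s /negPf sk; rewrite /to_form sk. Qed.

Lemma to_form_linear k : linear (@to_form k).
Proof.
move=> a f f'; apply/funext => s; rewrite /to_form !fctE.
by case: eqP => // _; rewrite scaler0 addr0.
Qed.

HB.instance Definition _ k :=
  GRing.isLinear.Build F _ _ _ (@to_form k) (@to_form_linear k).

Lemma form_to_form k (f : ('I_k -> g) -> M) :
  multilinear f -> alternating f -> form (to_form f).
Proof.
move=> fl fa; split=> [s1 s2 a x y|s1 x s2]; rewrite /to_form !size_cat /=.
  case: eqP => [sk|_]; last by rewrite scaler0 addr0.
  have ik : (size s1 < k)%N by rewrite -sk addnS ltnS leq_addr.
  have E z : f (fun i => (s1 ++ z :: s2)`_i) =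
      f (set_arg (fun i => (s1 ++ 0 :: s2)`_i) (Ordinal ik) z).
    congr f; apply/funext => i; rewrite /set_arg -val_eqE /= !nth_cat.
    case: ltngtP => // [lt|->]; last by rewrite subnn.
    by rewrite -(subnKC lt) addSn -addnS addKn.
  by rewrite !E; exact: fl.
case: eqP => [sk|//].
have ik : (size s1 < k)%N by rewrite -sk addnS ltnS leq_addr.
have jk : ((size s1).+1 < k)%N by rewrite -sk !addnS !ltnS leq_addr.
apply: (fa _ (Ordinal ik) (Ordinal jk)) => /=.
  by rewrite -val_eqE /= neq_ltn ltnSn.
by rewrite !nth_cat ltnn subnn ltnNge leqnSn /= subSnn.
Qed.

(** The terms in which the first argument is differentiated, or is part of the
    bracket, form the Lie derivative along it, by [act_move]; the other ones
    form the differential of the interior product. *)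
Lemma cedE (f : seq g -> M) s : form f ->
  ced rho f s =
    \sum_(i < size s) (-1) ^+ i *: rho s`_i (f (del i s)) +
    \sum_(i < size s) \sum_(j < size s | (i < j)%N)
      (-1) ^+ (i + j) *: f (lie s`_i s`_j :: del i (del j s)).
Proof.
elim: s f => [|y s IH] f ff /=; first by rewrite !big_ord0 addr0.
rewrite IH; last exact: form_ins.
rewrite /lieder act_move // !big_ord_recl /= expr0 scale1r.
rewrite [\sum_(j < _ | (0 < j)%N) _]big_mkcond big_ord_recl /= add0r.
rewrite del0.
under [X in _ = _ + X + _]eq_bigr => i _ do rewrite exprS mulN1r scaleNr delS.
under [X in _ = _ + (X + _)]eq_bigr => i _.
  rewrite exprS mulN1r scaleNr delS del0.
  over.
under [X in _ = _ + (_ + X)]eq_bigr => i _.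
  rewrite big_mkcond big_ord_recl /= add0r -big_mkcond /=.
  over.
rewrite !sumrN opprD -!addrA; congr (_ + _).
rewrite addrCA; congr (_ + (_ + _)).
rewrite -sumrN; apply: eq_bigr => i _; rewrite -sumrN; apply: eq_bigr => j _.
rewrite /bump /= !add1n addSn addnS !exprS !mulN1r opprK -scalerN; congr (_ *: _).
have := congr1 (fun u : seq g -> M => u (del i (del j s)))
  (insC y (lie s`_i s`_j) ff).
by rewrite /= !add0n !delS => E; exact: esym E.
Qed.

Lemma ce_diffE k (f : ('I_k -> g) -> M) (s : seq g) :
    multilinear f -> alternating f -> size s = k.+1 ->
  ce_diff rho f (fun i => s`_i) = ced rho (to_form f) s.
Proof.
move=> fl fa sk; rewrite cedE; last exact: form_to_form.
have sdel i : (i < k.+1)%N -> size (del i s) = k.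
  move=> ik; rewrite size_cat size_drop size_takel sk //; last exact: ltnW.
  by rewrite subSS subnKC.
rewrite /ce_diff sk; congr (_ + _).
  apply: eq_bigr => i _; congr (_ *: rho _ _).
  rewrite /to_form sdel // eqxx; congr f; apply/funext => m.
  by rewrite nth_del.
apply: eq_bigr => i _; apply: eq_bigr => j ij; congr (_ *: _).
rewrite /to_form /=.
have k0 : (0 < k)%N by move: (ltn_ord j); rewrite ltnS; apply: leq_trans;
  exact: leq_trans ij.
have ik : (i < k)%N by rewrite (leq_trans ij) // -ltnS.
have -> : (size (del i (del j s))).+1 = k.
  rewrite size_cat size_drop size_takel sdel //; last exact: ltnW.
  by lia.
rewrite eqxx; congr f; apply/funext => -[[|m] mk] //=.
rewrite /bracket_args /= !nth_del inordK //; rewrite /bump; lia.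
Qed.

End CochainForms.

(** * Coordinates on the space of homogeneous forms *)

Lemma gtn_irr : irreflexive gtn.
Proof. by move=> x; rewrite /= ltnn. Qed.

Lemma gtn_tr : transitive gtn.
Proof. by move=> y x z /= yx zy; exact: ltn_trans zy yx. Qed.

Lemma gtn_asym : antisymmetric gtn.
Proof. by move=> x y /andP[/= xy yx]; move: (ltn_trans xy yx); rewrite ltnn. Qed.

Lemma sorted_gtn_uniq l : sorted gtn l -> uniq l.
Proof. exact: (sorted_uniq gtn_tr gtn_irr). Qed.

(** Strictly decreasing lists of indices label the basis of an exterior
    power. *)
Fixpoint combs (n k : nat) : seq (seq nat) :=
  match n, k with
  | _, 0 => [:: [::]]
  | 0, _.+1 => [::]
  | n'.+1, k'.+1 => map (cons n') (combs n' k') ++ combs n' k'.+1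
  end.

Lemma combsP n k l :
  reflect [/\ size l = k, sorted gtn l & all (gtn n) l] (l \in combs n k).
Proof.
apply: (iffP idP).
  elim: n k l => [|n IH] [|k] l //=; rewrite ?inE; try by move/eqP->.
  rewrite mem_cat => /orP[/mapP[l' /IH[<- sl al] ->]|/IH[-> -> al]].
    split=> //=; last first.
      by rewrite ltnSn; apply: sub_all al => m /=; exact: ltnW.
    by rewrite path_min_sorted.
  by split=> //; apply: sub_all al => m /=; exact: ltnW.
elim: n k l => [|n IH] [|k] l //= [].
- by move/size0nil->.
- by case: l.
- by move/size0nil->.
case: l => [//|x l] [sl] /= xl /andP[xn al]; rewrite mem_cat.
have lx : all (gtn x) l.
  by move: xl; rewrite path_sortedE; [case/andP|exact: gtn_tr].
move: xn; rewrite ltnS leq_eqVlt => /orP[/eqP xn|xn].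
  subst x.
  rewrite map_f //; apply: IH; split=> //; try exact: path_sorted xl.
apply/orP; right; apply: IH; split=> //=; first by rewrite sl.
rewrite xn; apply: sub_all lx => m /= mx; exact: ltn_trans mx xn.
Qed.

Lemma combs_uniq n k : uniq (combs n k).
Proof.
elim: n k => [|n IH] [|k] //=.
rewrite cat_uniq IH map_inj_uniq ?IH; last by move=> ? ? [].
rewrite andbT; apply/hasPn => l /combsP[_ _ al]; apply/mapP => -[l' _ El].
by move: al; rewrite El /= ltnn.
Qed.

Lemma combs_big n k : (n < k)%N -> combs n k = [::].
Proof.
by elim: n k => [|n IH] [|k] //= nk; rewrite !IH // ltnW.
Qed.

Section Coordinates.
Variables (F : fieldType) (g : lieAlgType F) (n : nat).
Variables (b : nat -> g) (co : nat -> {scalar g}).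
Hypothesis co_b : forall i j, (i < n)%N -> (j < n)%N -> co j (b i) = (i == j)%:R.
Hypothesis sum_co : forall x, x = \sum_(i < n) co i x *: b i.

Definition idx k : seq (seq nat * nat) :=
  [seq (l, m) | l <- combs n k, m <- iota 0 n].

Lemma idx_uniq k : uniq (idx k).
Proof.
apply: allpairs_uniq; [exact: combs_uniq|exact: iota_uniq|].
by move=> [? ?] [? ?] _ _ [-> ->].
Qed.

Lemma idxP k l m : ((l, m) \in idx k) = (l \in combs n k) && (m < n)%N.
Proof.
apply/allpairsP/andP => [[[l' m'] /= [Hl Hm [-> ->]]]|[Hl Hm]].
  by rewrite mem_iota in Hm.
by exists (l, m); split => //=; rewrite mem_iota.
Qed.

Definition cspace k := {ffun seq_sub (idx k) -> F^o}.

(** The minors of the matrix of coordinates form the dual basis of the values on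
    strictly decreasing lists of basis vectors. *)
Definition det_cochain k (w : cspace k) (x : 'I_k -> g) : g :=
  \sum_(p : seq_sub (idx k))
    (\det (\matrix_(i < k, j < k) co (nth 0%N (ssval p).1 j) (x i)) * w p)
      *: b (ssval p).2.

Lemma det_cochain_multilinear k (w : cspace k) : multilinear (det_cochain w).
Proof.
move=> x i a y z /=; rewrite /det_cochain scaler_sumr -big_split /=.
apply: eq_bigr => p _; rewrite scalerA mulrA -scalerDl -mulrDl.
congr (_ * _ *: _); rewrite -[X in _ = _ + X]mul1r.
apply: (@determinant_multilinear _ _ _ _ _ i).
- apply/rowP => j; rewrite !mxE /set_arg eqxx mul1r.
  by rewrite linearP.
- apply/matrixP => i' j; rewrite !mxE /set_arg.
  by rewrite eq_sym (negPf (neq_lift _ _)).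
- apply/matrixP => i' j; rewrite !mxE /set_arg.
  by rewrite eq_sym (negPf (neq_lift _ _)).
Qed.

Lemma det_cochain_alternating k (w : cspace k) : alternating (det_cochain w).
Proof.
move=> x i j ij xij; rewrite /det_cochain big1 // => p _.
rewrite (determinant_alternate ij) ?mul0r ?scale0r // => m.
by rewrite !mxE xij.
Qed.

Definition Psi k (w : cspace k) : seq g -> g := to_form (det_cochain w).

Lemma form_Psi k (w : cspace k) : form (Psi w).
Proof.
apply: form_to_form; first exact: det_cochain_multilinear.
exact: det_cochain_alternating.
Qed.

Lemma homog_Psi k (w : cspace k) : homog k (Psi w).
Proof. exact: homog_to_form. Qed.

Lemma Psi_linear k : linear (@Psi k).
Proof.
move=> a w w'; rewrite /Psi -linearP; congr to_form; apply/funext => x.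
rewrite !fctE /det_cochain scaler_sumr -big_split /=; apply: eq_bigr => p _.
by rewrite !ffunE mulrDr scalerDl scalerA mulrCA.
Qed.

HB.instance Definition _ k :=
  GRing.isLinear.Build F _ _ _ (@Psi k) (@Psi_linear k).

Definition Phi k (f : seq g -> g) : cspace k :=
  [ffun p => co (ssval p).2 (f (map b (ssval p).1))].

Lemma Phi_linear k : linear (@Phi k).
Proof. by move=> a f f'; apply/ffunP => p; rewrite !ffunE linearP. Qed.

HB.instance Definition _ k :=
  GRing.isLinear.Build F _ _ _ (@Phi k) (@Phi_linear k).

(** Two different decreasing lists of the same length do not have the same
    elements, so that the matrix has a zero row. *)
Lemma det_b k l l' : l \in combs n k -> l' \in combs n k ->
  \det (\matrix_(i < k, j < k) co (nth 0%N l' j) (map b l)`_i) = (l == l')%:R.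
Proof.
move=> /combsP[sl ol al] /combsP[sl' ol' al'].
have lt m (i : 'I_k) : size m = k -> all (gtn n) m -> (nth 0 m i < n)%N.
  by move=> sm /allP; apply; rewrite mem_nth // sm.
have E i j : (\matrix_(i < k, j < k) co (nth 0%N l' j) (map b l)`_i) i j
    = (nth 0%N l i == nth 0%N l' j)%:R.
  by rewrite mxE (nth_map 0%N) ?sl // co_b // lt.
have [ll'|ll'] := eqVneq l l'.
  rewrite -[RHS](det1 _ k); congr (\det _); apply/matrixP => i j.
  rewrite E mxE -ll' nth_uniq ?sl //; exact: sorted_gtn_uniq.
have [i Hi] : exists i : 'I_k, nth 0%N l i \notin l'.
  apply/existsP; apply: contraT; rewrite negb_exists => /forallP sub.
  have sub' : {subset l <= l'}.
    move=> x xl; have xk : (index x l < k)%N by rewrite -sl index_mem.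
    by have := sub (Ordinal xk); rewrite negbK /= nth_index.
  have lesz : (size l' <= size l)%N by rewrite sl sl'.
  have [_ eqll'] := uniq_min_size (sorted_gtn_uniq ol) sub' lesz.
  case/eqP: ll'; apply: (sorted_eq gtn_tr gtn_asym) => //.
  by apply: uniq_perm => //; exact: sorted_gtn_uniq.
rewrite (expand_det_row _ i) big1 // => j _; rewrite E.
case: eqP => [e|]; rewrite ?mul0r //.
by case/negP: Hi; rewrite e mem_nth // sl'.
Qed.

Lemma PhiK k (w : cspace k) : Phi k (Psi w) = w.
Proof.
apply/ffunP => p; rewrite ffunE; case: p => -[l m] lm /=.
have := lm; rewrite idxP => /andP[Hl Hm].
have [sl _ _] := combsP _ _ _ Hl.
rewrite /Psi /to_form size_map sl eqxx /det_cochain linear_sum /=.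
rewrite (bigD1 (SeqSub lm)) //= det_b // eqxx mul1r linearZ /= co_b // eqxx.
rewrite mulr1 big1 ?addr0 // => -[[l' m'] lm'] /=.
have := lm'; rewrite idxP => /andP[Hl' Hm'].
rewrite -val_eqE /= => ne; rewrite det_b // linearZ /= co_b //.
have [ll|] := eqVneq l l'; last by rewrite !mul0r.
have [mm|] := eqVneq m' m; last by rewrite mulr0.
by case/negP: ne; rewrite ll mm.
Qed.

Lemma form_perm0 (f : seq g -> g) s t : form f -> perm_eq s t -> f s = 0 -> f t = 0.
Proof.
move=> ff; apply: (@catCA_perm_ind _ (fun u => f u = 0)) => s1 s2 s3.
elim: s1 s2 s3 f ff => [//|x s1 IH] s2 s3 f ff /= h.
have mv y u v (f' : seq g -> g) : form f' -> f' (y :: u ++ v) = 0 ->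
    f' (u ++ y :: v) = 0.
  elim: u f' => [//|z u IHu] f' ff' /= h'.
  apply: (IHu (ins z f')); first exact: form_ins.
  have E := congr1 (fun h : seq g -> g => h (u ++ v)) (insC y z ff').
  rewrite -[LHS]/(ins y (ins z f') (u ++ v)) E fctE.
  by rewrite -[X in - X]/(f' (y :: z :: u ++ v)) h' oppr0.
apply: (mv) => //; rewrite -[LHS]/(ins x f (s2 ++ s1 ++ s3)).
by apply: IH => //; exact: form_ins.
Qed.

(** Multilinearity reduces to lists of basis vectors, alternation to lists
    without repetition, and permuting the arguments to decreasing ones. *)
Lemma Phi_eq0 k (f : seq g -> g) : form f -> homog k f -> Phi k f = 0 -> f = 0.
Proof.
move=> ff hf f0.
have bl l : all (gtn n) l -> f (map b l) = 0.
  move=> al; have [lk|] := eqVneq (size l) k; last first.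
    by move=> lk; apply: hf; rewrite size_map.
  have [ul|ul] := boolP (uniq l); last first.
    apply: form_dup ff _; apply: contra ul; exact: map_uniq.
  pose l' := sort geq l.
  have pl : perm_eq l' l by rewrite /l' perm_sort.
  apply: (@form_perm0 f (map b l')) => //; first exact: perm_map.
  have Hl : l' \in combs n k.
    apply/combsP; split; first by rewrite size_sort.
      rewrite gtn_sorted_uniq_geq (perm_uniq pl) ul /=.
      by apply: sort_sorted => x y; exact: leq_total.
    by rewrite (perm_all _ pl).
  rewrite [LHS]sum_co big1 // => i _.
  have Hp : (l', val i) \in idx k by rewrite idxP Hl /=.
  have := congr1 (fun w : cspace k => w (SeqSub Hp)) f0.
  by rewrite !ffunE /= => ->; rewrite scale0r.
have bls s l : all (gtn n) l -> f (map b l ++ s) = 0.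
  elim: s l => [|x s IH] l al; first by rewrite cats0 bl.
  have lin := ff.1 (map b l) s.
  rewrite [x]sum_co.
  have H0 : f (map b l ++ 0 :: s) = 0.
    by have := lin (-1) 0 0; rewrite /= scaler0 addr0 scaleN1r addNr.
  elim/big_rec: _ => [|i y _ Hy] /=; first by [].
  rewrite lin Hy addr0 -cat_rcons -map_rcons IH ?scaler0 //.
  by rewrite all_rcons /= ltn_ord.
by apply/funext => s; exact: (bls s [::]).
Qed.

Lemma PsiK k (f : seq g -> g) : form f -> homog k f -> Psi (Phi k f) = f.
Proof.
move=> ff hf; apply/eqP; rewrite -subr_eq0; apply/eqP.
apply: (@Phi_eq0 k); first by apply: formB => //; exact: form_Psi.
  by move=> s sk; rewrite -[LHS]/(Psi _ s - f s) hf // homog_Psi // subr0.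
by rewrite linearB /= PhiK subrr.
Qed.

End Coordinates.

(** * Finite-dimensional [sl2]-theory *)

Section Sl2Triples.
Variables (F : numFieldType).

Record sl2_triple (W : lmodType F) (e f h : {linear W -> W}) : Prop := Sl2Triple {
  triple_ef : forall w, e (f w) = f (e w) + h w;
  triple_he : forall w, h (e w) = e (h w) + e w *+ 2;
  triple_hf : forall w, h (f w) = f (h w) - f w *+ 2
}.

Variables (W : lmodType F).

Lemma triple_swap (e f h : {linear W -> W}) :
  sl2_triple e f h -> sl2_triple f e (\- h).
Proof.
move=> [ef he hf]; split=> w /=.
- by rewrite ef addrK.
- by rewrite hf linearN /= opprB addrC.
- by rewrite he linearN /= opprD.
Qed.

(** Twice the Casimir operator, which has integer coefficients. *)
Definition casimir (e f h : W -> W) (w : W) : W :=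
  e (f w) *+ 2 + f (e w) *+ 2 + h (h w).

Lemma casimir_swap (e f h : {linear W -> W}) w :
  casimir f e (\- h) w = casimir e f h w.
Proof. by rewrite /casimir /= linearN opprK (addrC (f _ *+ 2)). Qed.

(** A polynomial with integer roots, of which 0 is a simple one, annihilates [h].
    The factor [h] comes first so that the other ones can be stripped off a
    vector of the form [h w]. *)
Definition integral_weights (h : W -> W) (ws : seq int) : Prop :=
  0 \notin ws /\ forall w, foldr (fun c v => h v - c%:~R *: v) (h w) ws = 0.

Lemma integral_weights_eigen (h : {linear W -> W}) ws c w :
  integral_weights h ws -> h w = c%:~R *: w -> c \notin 0 :: ws -> w = 0.
Proof.
move=> [_ hws] hw; rewrite inE negb_or => /andP[c0 cws].
have E : foldr (fun c v => h v - c%:~R *: v) (h w) ws =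
    (c%:~R * \prod_(d <- ws) (c - d)%:~R) *: w.
  elim: (ws) => [|d ds IH] /=; first by rewrite big_nil mulr1 hw.
  by rewrite IH linearZ /= hw big_cons !scalerA -scalerBl; congr (_ *: _); ring.
have /eqP := hws w; rewrite E scaler_eq0 => /orP[|/eqP //].
rewrite mulf_eq0 intr_eq0 (negPf c0) /=.
rewrite prodf_seq_eq0 => /hasP[d dws /=]; rewrite intr_eq0 subr_eq0 => /eqP cd.
by rewrite cd dws in cws.
Qed.

Lemma integral_weightsN (h : {linear W -> W}) ws :
  integral_weights h ws -> integral_weights (\- h) (map -%R ws).
Proof.
move=> [w0 hws]; split.
  by rewrite -oppr0 mem_map //; exact: oppr_inj.
move=> w; have E : foldr (fun c v => (\- h) v - c%:~R *: v) ((\- h) w) (map -%R ws)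
    = (-1) ^+ (size ws).+1 *: foldr (fun c v => h v - c%:~R *: v) (h w) ws.
  elim: (ws) => [|d ds IH] /=; first by rewrite scaleN1r.
  rewrite IH linearZ /= [in RHS]exprS -scalerA scaleN1r.
  rewrite scalerBr opprB mulrNz scaleNr opprK addrC; congr (_ - _).
  by rewrite !scalerA mulrC.
by rewrite E hws scaler0.
Qed.

Section Triple.
Variables (e f h : {linear W -> W}) (ws : seq int).
Hypotheses (tr : sl2_triple e f h) (hws : integral_weights h ws).

Lemma casimir_e w : casimir e f h (e w) = e (casimir e f h w).
Proof.
case: tr => ef he hf.
have fe x : f (e x) = e (f x) - h x by rewrite ef addrK.
rewrite /casimir !mulr2n.
rewrite !(fe, he, mulr2n, linearD e, linearD f, linearD h, linearB e, linearN e).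
abel.
Qed.

Lemma weight_bound : exists N : nat, forall (n : nat) v,
  h v = n%:R *: v -> (N < n)%N -> v = 0.
Proof.
exists (\max_(d <- ws) `|d|)%N => n v hv Nn.
apply: (integral_weights_eigen (c := n) hws) => //; rewrite inE negb_or.
apply/andP; split; first by case: (n) Nn.
apply/negP => nws; move: Nn; rewrite ltnNge => /negP; apply.
by have := @leq_bigmax_seq _ ws xpredT (fun d : int => `|d|%N) _ nws isT.
Qed.

(** A nonzero vector of positive weight on which [e f] acts by a nonpositive
    scalar would generate an infinite string: [f e] acts on it by a negative
    scalar, so [e v] is nonzero and satisfies the same conditions. *)
Lemma ef_nonpos_eq0 (n c : nat) v :
  (0 < n)%N -> h v = n%:R *: v -> e (f v) = - (c%:R *: v) -> v = 0.
Proof.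
case: tr => ef he hf; have [N HN] := weight_bound.
have [m] := ubnP (N.+1 - n); elim: m n c v => // m IH n c v mn n0 hv efv.
have [/HN|nN] := ltnP N n; first exact.
have fev : f (e v) = - ((c + n)%:R *: v).
  by move/eqP: (ef v); rewrite efv hv -subr_eq natrD scalerDl opprD => /eqP ->.
have ev0 : e v = 0.
  apply: (IH n.+2 (c + n)%N); [lia|by []| |].
    by rewrite he hv linearZ /= !scaler_nat -mulrnDr addn2.
  by rewrite fev linearN linearZ.
have /eqP := fev; rewrite ev0 linear0 eq_sym oppr_eq0 scaler_eq0 pnatr_eq0.
by rewrite addn_eq0 => /orP[/andP[_ /eqP n00]|/eqP //]; rewrite n00 in n0.
Qed.

(** Raising a vector of positive weight ends with a highest weight vector, of
    weight [n > 0], on which the operator acts by [n (n + 2)]. *)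
Lemma casimir2_pos (n : nat) v : (0 < n)%N -> h v = n%:R *: v ->
  casimir e f h (casimir e f h v) = 0 -> v = 0.
Proof.
case: (tr) => ef he hf; have [N HN] := weight_bound.
have [m] := ubnP (N.+1 - n); elim: m n v => // m IH n v mn n0 hv cv.
have [/HN|nN] := ltnP N n; first exact.
have ev0 : e v = 0.
  apply: (IH n.+2); [lia|by []| |].
    by rewrite he hv linearZ /= !scaler_nat -mulrnDr addn2.
  by rewrite !casimir_e cv linear0.
have casZ a : casimir e f h (a *: v) = (a * (n * n.+2)%:R) *: v.
  rewrite /casimir !linearZ /= ef ev0 linear0 add0r scaler0 mul0rn addr0 !hv.
  rewrite [h (_ *: _)]linearZ /= hv -scaler_nat !scalerA -scalerDl; congr (_ *: _).
  by rewrite natrM -addn2 natrD; ring.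
have c1 := casZ 1; rewrite scale1r mul1r in c1; move: cv; rewrite c1 casZ => /eqP.
rewrite scaler_eq0 -natrM pnatr_eq0 !muln_eq0 /= !orbF orbb => /orP[|/eqP//].
by case: (n) n0.
Qed.

End Triple.

Section Invariants.
Variables (e f h : {linear W -> W}) (ws : seq int).
Hypotheses (tr : sl2_triple e f h) (hws : integral_weights h ws).

Let trN := triple_swap tr.
Let hwsN := integral_weightsN hws.

Lemma casimir_f w : casimir e f h (f w) = f (casimir e f h w).
Proof.
by have := casimir_e trN w; rewrite (casimir_swap e f h) (casimir_swap e f h w).
Qed.

Lemma casimir_h w : casimir e f h (h w) = h (casimir e f h w).
Proof.
have casB x y : casimir e f h (x - y) = casimir e f h x - casimir e f h y.
  by rewrite /casimir !linearB /= !mulrnBl; abel.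
have hE x : h x = e (f x) - f (e x) by rewrite (triple_ef tr) addrC addKr.
by rewrite !hE casB !(casimir_e tr, casimir_f).
Qed.

Lemma zero_weight_e_f w : h w = 0 -> e w = 0 -> f w = 0.
Proof.
move=> hw ew; apply: (@ef_nonpos_eq0 _ _ _ _ trN hwsN 2 0) => //.
  by rewrite /= (triple_hf tr) hw linear0 sub0r opprK scaler_nat.
by rewrite scale0r oppr0 (triple_ef tr) ew hw !linear0 addr0 linear0.
Qed.

(** The kernel of the square is stable under the triple. It has no nonzero
    weight by [casimir2_pos], applied also to the opposite triple; so [h]
    vanishes on it, and [e] and [f], which shift weights, vanish too. *)
Lemma casimir2_ker w : casimir e f h (casimir e f h w) = 0 ->
  [/\ e w = 0, f w = 0 & h w = 0].
Proof.
pose U v := casimir e f h (casimir e f h v) = 0.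
have casP a x y :
    casimir e f h (a *: x + y) = a *: casimir e f h x + casimir e f h y.
  rewrite /casimir !linearP /= !mulr2n !scalerDr; abel.
have UP a x y : U x -> U y -> U (a *: x + y).
  by rewrite /U => Ux Uy; rewrite !casP Ux Uy scaler0 addr0.
have Uh x : U x -> U (h x) by rewrite /U => Ux; rewrite !casimir_h Ux linear0.
have Ue x : U x -> U (e x) by rewrite /U => Ux; rewrite !(casimir_e tr) Ux linear0.
have Uf x : U x -> U (f x) by rewrite /U => Ux; rewrite !casimir_f Ux linear0.
have Uint (c : int) x : c != 0 -> h x = c%:~R *: x -> U x -> x = 0.
  case: c => [n|n] c0 hx Ux.
    by apply: (casimir2_pos tr hws (n := n)) => //; rewrite lt0n.
  apply: (casimir2_pos trN hwsN (n := n.+1)) => //=.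
    by rewrite hx NegzE mulrNz scaleNr opprK.
  by rewrite !casimir_swap.
have Uh0 x : U x -> h x = 0.
  case: hws => ws0 hws0 Ux; have := hws0 x; move: ws0.
  elim: (ws) => [//|c cs IH] /=; rewrite inE negb_or => /andP[c0 cs0].
  set v := foldr _ _ _ => /eqP; rewrite subr_eq0 => /eqP hv.
  apply: IH => //; apply: Uint hv _; first by rewrite eq_sym.
  rewrite /v; elim: (cs) => [|d ds IHd] /=; first exact: Uh.
  by rewrite -scaleNr addrC; apply: UP => //; exact: Uh.
move=> Uw; split; last exact: Uh0.
  apply: (Uint 2) => //; last exact: Ue.
  by rewrite (triple_he tr) Uh0 // linear0 add0r -scaler_nat.
apply: (Uint (- 2)) => //; last exact: Uf.
by rewrite (triple_hf tr) Uh0 // linear0 sub0r -scaler_nat mulrNz scaleNr.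
Qed.

End Invariants.
End Sl2Triples.

Section InvariantDim.
Variables (F : numFieldType) (W : vectType F).
Variables (e f h : 'End(W)) (ws : seq int) (U : {vspace W}).
Hypotheses (tr : sl2_triple e f h) (hws : integral_weights h ws).
Hypotheses (Ue : forall u, u \in U -> e u \in U)
           (Uf : forall u, u \in U -> f u \in U).

Definition eigen (h : 'End(W)) (c : int) : {vspace W} :=
  lker (h - c%:~R *: \1%VF).

Lemma eigenP (k : 'End(W)) c w : reflect (k w = c%:~R *: w) (w \in eigen k c).
Proof.
by rewrite memv_ker add_lfunE opp_lfunE scale_lfunE id_lfunE subr_eq0; exact: eqP.
Qed.

(** On the weight space 2 the map [e f] is injective, hence bijective. So [e]
    maps the weight space 0 onto the weight space 2. *)
Lemma invariant_dim :
  (\dim (U :&: eigen h 0 :&: lker e) + \dim (U :&: eigen h 2))%N =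
  \dim (U :&: eigen h 0).
Proof.
rewrite -(limg_ker_dim e (U :&: eigen h 0)); congr (_ + _)%N.
have he w : h (e w) = e (h w) + e w *+ 2 := triple_he tr w.
have hf w : h (f w) = f (h w) - f w *+ 2 := triple_hf tr w.
set X := (U :&: eigen h 2)%VS; set Y := (U :&: eigen h 0)%VS.
have fX u : u \in X -> f u \in Y.
  rewrite !memv_cap => /andP[uU /eigenP hu]; rewrite Uf //=; apply/eigenP.
  rewrite hf hu linearZ /= -scaler_nat scale0r.
  by rewrite subrr.
have eY u : u \in Y -> e u \in X.
  rewrite !memv_cap => /andP[uU /eigenP hu]; rewrite Ue //=; apply/eigenP.
  by rewrite he hu scale0r linear0 add0r -scaler_nat.
have inj : (X :&: lker (e \o f)%VF = 0)%VS.
  apply/eqP; rewrite -subv0; apply/subvP => v; rewrite !memv_cap memv_ker.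
  move=> /andP[/andP[_ /eigenP hv] /eqP]; rewrite lfunE /= => efv.
  rewrite memv0; apply/eqP; apply: (ef_nonpos_eq0 tr hws (n := 2) (c := 0)) => //.
  by rewrite scale0r oppr0; exact: efv.
have efX : ((e \o f)%VF @: X <= X)%VS.
  by apply/subvP => _ /memv_imgP[u uX ->]; rewrite lfunE /=; apply/eY/fX.
have := limg_ker_dim (e \o f)%VF X; rewrite inj dimv0 add0n => dX.
have XE : ((e \o f)%VF @: X = X)%VS by apply/eqP; rewrite -dimv_leqif_eq ?dX.
apply/eqP; rewrite eqn_leq; apply/andP; split; last first.
  by apply: dimvS; apply/subvP => _ /memv_imgP[u uY ->]; exact: eY.
rewrite -XE limg_comp; apply/dimvS/limgS/subvP => _ /memv_imgP[u uX ->].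
exact: fX.
Qed.

End InvariantDim.

(** * The irreducible representations of [sl2] *)

Section Sl2Basis.
Variable F : fieldType.

Definition sl2_mx (a b c : F) : 'M[F]_2 :=
  \matrix_(i, j) if i == 0 then if j == 0 then c else a
                 else if j == 0 then b else - c.

Lemma sl2_mx_traceless a b c : sl2_mx a b c \in traceless (F := F).
Proof. by rewrite inE /mxtrace !big_ord_recl big_ord0 !mxE /= addr0 subrr. Qed.

Definition sl2_of a b c : sl2 F := Sl2 (sl2_mx_traceless a b c).

Definition sl2E := sl2_of 1 0 0.
Definition sl2F := sl2_of 0 1 0.
Definition sl2H := sl2_of 0 0 1.

Lemma sl2_eq (x y : sl2 F) :
  x 0 1 = y 0 1 -> x 1 0 = y 1 0 -> x 0 0 = y 0 0 -> x = y.
Proof.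
move=> e01 e10 e00; apply: val_inj => /=; apply/matrixP => i j.
have tr0 (z : sl2 F) : z 1 1 = - z 0 0.
  have := sl2P z; rewrite inE /mxtrace !big_ord_recl big_ord0 addr0.
  rewrite addrC addr_eq0 => /eqP; rewrite (_ : lift _ _ = 1) //; exact: val_inj.
have I2 (k : 'I_2) : k = 0 \/ k = 1.
  by case: k => -[|[|k]] kP; [left|right|by []]; exact: val_inj.
by case: (I2 i) => ->; case: (I2 j) => ->; rewrite // !tr0 e00.
Qed.

Lemma sl2_decomp (x : sl2 F) :
  x = x 0 1 *: sl2E + x 1 0 *: sl2F + x 0 0 *: sl2H.
Proof.
by apply: sl2_eq; rewrite /= !mxE /= !(mulr1, mulr0, addr0, add0r).
Qed.

Lemma sl2_lieE (x y : sl2 F) : [/\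
  lie x y 0 1 = (x 0 0 * y 0 1 - x 0 1 * y 0 0) *+ 2,
  lie x y 1 0 = (x 1 0 * y 0 0 - x 0 0 * y 1 0) *+ 2 &
  lie x y 0 0 = x 0 1 * y 1 0 - x 1 0 * y 0 1].
Proof.
have tr0 (z : sl2 F) : z 1 1 = - z 0 0.
  have := sl2P z; rewrite inE /mxtrace !big_ord_recl big_ord0 addr0.
  rewrite addrC addr_eq0 => /eqP; rewrite (_ : lift _ _ = 1) //; exact: val_inj.
have I1 : lift ord0 (ord0 : 'I_1) = 1 :> 'I_2 by exact: val_inj.
have I0 : ord0 = 0 :> 'I_2 by [].
by rewrite /lie /= !mxE !big_ord_recl !big_ord0 !I1 !I0; split; rewrite ?tr0; ring.
Qed.

Lemma lie_EF : lie sl2E sl2F = sl2H.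
Proof.
have [h01 h10 h00] := sl2_lieE sl2E sl2F.
by apply: sl2_eq; rewrite ?h01 ?h10 ?h00 /= !mxE /=; ring.
Qed.

Lemma lie_HE : lie sl2H sl2E = sl2E *+ 2.
Proof.
have [h01 h10 h00] := sl2_lieE sl2H sl2E.
by apply: sl2_eq; rewrite mulr2n ?h01 ?h10 ?h00 /= !mxE /=; ring.
Qed.

Lemma lie_HF : lie sl2H sl2F = - (sl2F *+ 2).
Proof.
have [h01 h10 h00] := sl2_lieE sl2H sl2F.
by apply: sl2_eq; rewrite mulr2n ?h01 ?h10 ?h00 /= !mxE /=; ring.
Qed.

End Sl2Basis.

Section RepLemmas.
Variables (F : fieldType) (g : lieAlgType F) (M : lmodType F).
Variable rho : lieRep g M.

Lemma repDl x y m : rho (x + y) m = rho x m + rho y m.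
Proof. by have := rep_linearl rho m 1 x y; rewrite !scale1r. Qed.

Lemma rep0l m : rho 0 m = 0.
Proof. by apply: (addrI (rho 0 m)); rewrite -repDl !addr0. Qed.

Lemma repZl a x m : rho (a *: x) m = a *: rho x m.
Proof. by have := rep_linearl rho m a x 0; rewrite rep0l !addr0. Qed.

Lemma repNl x m : rho (- x) m = - rho x m.
Proof. by rewrite -[- x]scaleN1r repZl scaleN1r. Qed.

End RepLemmas.

Lemma rep_triple (F : numFieldType) (M : lmodType F) (rho : lieRep (sl2 F) M) :
  sl2_triple (rho (sl2E F)) (rho (sl2F F)) (rho (sl2H F)).
Proof.
split=> w /=.
- by rewrite -lie_EF rep_lie addrC subrK.
- by have := rep_lie rho (sl2H F) (sl2E F) w;
  rewrite lie_HE !mulr2n repDl => ->; rewrite addrC subrK.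
- have := rep_lie rho (sl2H F) (sl2F F) w; rewrite lie_HF !mulr2n repNl repDl => ->.
  by rewrite addrC subrK.
Qed.

Section EigenFree.
Variables (F : fieldType) (V : vectType F) (h : {linear V -> V}).

Lemma eigen_free (s : seq V) (c : nat -> F) :
    (forall i, (i < size s)%N -> s`_i != 0 /\ h s`_i = c i *: s`_i) ->
    {in gtn (size s) &, injective c} ->
  free s.
Proof.
elim/last_ind: s => [|s x IH] hs ic; first exact: nil_free.
have lt i : (i < size s)%N -> (i < size (rcons s x))%N.
  by rewrite size_rcons ltnS => /ltnW.
have fs : free s.
  apply: IH => [i si|i j si sj]; last by apply: ic; rewrite inE lt.
  by have := hs i (lt i si); rewrite nth_rcons si.
have [] := hs (size s); rewrite ?size_rcons ?ltnSn // nth_rcons ltnn eqxx => x0 hx.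
have -> : free (rcons s x) = free (x :: s) by apply: perm_free; rewrite perm_rcons.
rewrite free_cons fs andbT; apply/negP => /(coord_span (X := in_tuple s)) xE.
have h0 :
    \sum_(i < size s) (coord (in_tuple s) i x * (c i - c (size s))) *: s`_i = 0.
  rewrite (eq_bigr (fun i : 'I_(size s) =>
             coord (in_tuple s) i x *: (h s`_i - c (size s) *: s`_i))).
    rewrite (eq_bigr (fun i : 'I_(size s) => h (coord (in_tuple s) i x *: s`_i)
        - c (size s) *: (coord (in_tuple s) i x *: s`_i))).
      by rewrite sumrB -linear_sum -scaler_sumr -[\sum_(i < _) _]xE hx subrr.
      by move=> i _; rewrite scalerBr [h (_ *: _)]linearZ /= [in LHS]scalerA
        [in RHS]scalerA mulrC.
  move=> i _; have := (hs i (lt i (ltn_ord i))).2; rewrite nth_rcons ltn_ord => ->.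
  by rewrite -scalerBl scalerA.
case/negP: x0; apply/eqP; rewrite xE big1 // => i _.
have /eqP := freeP (X := in_tuple s) fs _ h0 i.
rewrite mulf_eq0 => /orP[/eqP ->|]; first by rewrite scale0r.
rewrite subr_eq0 => /eqP /ic; rewrite !inE size_rcons ltnS => h1.
have E := h1 (ltnW (ltn_ord i)) (leqnn _).
by have := ltn_ord i; rewrite E ltnn.
Qed.

Lemma eigen_eq0 (v : nat -> V) (c : nat -> F) :
    (forall i, h (v i) = c i *: v i) -> injective c -> exists i, v i = 0.
Proof.
move=> hv ic; apply/not_existsP => nz.
have : free (mkseq v (dim V).+1).
  apply: (eigen_free (c := c)) => [i|i j _ _]; last exact: ic.
  by rewrite size_mkseq => iV; rewrite nth_mkseq //; split=> //; apply/eqP/nz.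
rewrite /free size_mkseq => /eqP E.
have := dimvS (subvf <<mkseq v (dim V).+1>>%VS); rewrite E dimvf ltnn.
by [].
Qed.

End EigenFree.

Section EigenvectorClosed.
Import VectorInternalTheory.

Lemma eigenvector_closed (F : numClosedFieldType) (V : vectType F)
    (h : {linear V -> V}) :
  (0 < dim V)%N -> exists (c : F) (v : V), v != 0 /\ h v = c *: v.
Proof.
move=> V0.
have [c /eigenvalueP[u uA u0]] :=
  eigenvalue_closed (lin1_mx (v2r \o h \o r2v)) V0.
exists c, (r2v u); split; first by rewrite -(linear0 r2v) (inj_eq (@r2v_inj _ _)).
by apply: v2r_inj; rewrite linearZ /= r2vK -uA mul_rV_lin1.
Qed.

End EigenvectorClosed.

(** The string generated by a highest weight vector under [f] spans a submodule,
    hence everything, and its length determines the highest weight. *)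
Lemma irreducible_weight_basis (F : numClosedFieldType) (V : vectType F)
    (rho : lieRep (sl2 F) V) n :
  irreducible_rep rho -> \dim {:V} = n.+1 ->
  exists (v : nat -> V) (cv : nat -> {scalar V}),
  [/\ forall i j, (i < n.+1)%N -> (j < n.+1)%N -> cv j (v i) = (i == j)%:R,
      forall x, x = \sum_(i < n.+1) cv i x *: v i &
      forall i, rho (sl2H F) (v i) = (n%:Z - (i.*2)%:Z)%:~R *: v i].
Proof.
move=> [_ irr] dV.
have V0 : (0 < dim V)%N by rewrite -dimvf dV.
pose e : {linear V -> V} := rho (sl2E F).
pose f : {linear V -> V} := rho (sl2F F).
pose h : {linear V -> V} := rho (sl2H F).
have [ef he hf] : sl2_triple e f h := rep_triple rho.
have [mu [w [w0 hw]]] := eigenvector_closed h V0.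
have hew i : h (iter i e w) = (mu + (i.*2)%:R) *: iter i e w.
  elim: i => [|i IH] /=; first by rewrite addr0.
  by rewrite he IH linearZ /= -scaler_nat -scalerDl -addrA -natrD -addnn;
    congr ((_ + _%:R) *: _); lia.
have [m0 wm] : exists m, iter m e w = 0.
  apply: (eigen_eq0 hew) => i j /addrI /eqP.
  by rewrite eqr_nat => /eqP /double_inj.
have [m [wm0 wm1]] : exists m, iter m e w != 0 /\ e (iter m e w) = 0.
  elim: m0 wm => [|m IH] wm; first by move: w0; rewrite -[w]/(iter 0 e w) wm eqxx.
  by have [/IH //|ne] := eqVneq (iter m e w) 0; exists m.
have [lam hv0] : exists lam, h (iter m e w) = lam *: iter m e w by eexists;
  exact: hew.
move: (iter m e w) wm0 wm1 hv0 => v0 v00 ev0 hv0 {w w0 hw hew m m0 wm mu}.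
pose v i := iter i f v0; have vS i : v i.+1 = f (v i) by [].
have hv i : h (v i) = (lam - (i.*2)%:R) *: v i.
  elim: i => [|i IH]; first by rewrite subr0.
  rewrite vS hf IH [f (_ *: _)]linearZ /= -scaler_nat -scalerBl -addrA -opprD
    -natrD.
  by congr ((_ - _%:R) *: _); lia.
have ev i : e (v i.+1) = (i.+1%:R * (lam - i%:R)) *: v i.
  elim: i => [|i IH]; first by rewrite /v /= ef ev0 linear0 add0r hv0 subr0 mul1r.
  rewrite (vS i.+1) ef IH [f (_ *: _)]linearZ /= -vS hv -scalerDl; congr (_ *: _).
  by rewrite -addnn !mulrS natrD !mulrS; ring.
have [m0 vm] : exists m, v m = 0.
  apply: (eigen_eq0 hv) => i j /addrI /oppr_inj /eqP.
  by rewrite eqr_nat => /eqP /double_inj.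
have [m [vm0 vm1]] : exists m, v m != 0 /\ v m.+1 = 0.
  elim: m0 vm => [|m IH] vm; first by move: v00; rewrite -[v0]/(v 0%N) vm eqxx.
  by have [/IH //|ne] := eqVneq (v m) 0; exists m.
have lamE : lam = m%:R.
  have /eqP := ev m; rewrite vm1 linear0 eq_sym scaler_eq0 (negPf vm0) orbF.
  by rewrite mulf_eq0 pnatr_eq0 /= subr_eq0 => /eqP.
have vnz i : (i <= m)%N -> v i != 0.
  move=> im; apply: contra vm0 => /eqP vi; apply/eqP.
  rewrite /v -(subnK im) iterD -/(v i) vi.
  by elim: (m - i)%N => //= k ->; rewrite linear0.
pose s := mkseq v m.+1.
have ss : size s = m.+1 by rewrite size_mkseq.
have sE i : (i <= m)%N -> s`_i = v i by move=> im; rewrite nth_mkseq.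
have fs : free s.
  apply: (eigen_free (h := h) (c := fun i => lam - (i.*2)%:R)) => [i|i j _ _].
    by rewrite ss ltnS => im; rewrite sE //; split; [exact: vnz|exact: hv].
  by move=> /addrI /oppr_inj /eqP; rewrite eqr_nat => /eqP /double_inj.
have vs i : (i <= m)%N -> v i \in <<s>>%VS.
  by move=> im; apply: memv_span; apply/mapP; exists i => //; rewrite mem_iota.
have ind (k : {linear V -> V}) : (forall i, (i <= m)%N -> k (v i) \in <<s>>%VS) ->
    forall u, u \in <<s>>%VS -> k u \in <<s>>%VS.
  move=> kv u /(coord_span (X := in_tuple s)) ->; rewrite linear_sum /=.
  apply: memv_suml => i _; rewrite linearZ /= memvZ //.
  have im : (i <= m)%N by rewrite -ltnS -ss.
  by rewrite sE //; exact: kv.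
have sf : <<s>>%VS = fullv.
  have [x u uU|s0|//] := irr <<s>>%VS.
    rewrite (sl2_decomp x) !repDl !repZl !memvD // memvZ //.
    - apply: (ind e) u uU => -[|i] im; first by rewrite ev0 mem0v.
      by rewrite ev memvZ // vs // ltnW.
    - apply: (ind f) u uU => i; rewrite leq_eqVlt => /orP[/eqP ->|im].
        by rewrite -[f _]/(v m.+1) vm1 mem0v.
      exact: vs im.
    - by apply: (ind h) u uU => i im; rewrite hv memvZ // vs.
  by have := vs 0 (leq0n m); rewrite s0 memv0 (negPf v00).
have mn : m = n.
  by have := fs; rewrite /free sf dV ss => /eqP [].
subst m; have ss' : size s == n.+1 by rewrite ss.
pose X := Tuple ss'; have bX : basis_of fullv X by rewrite basisEfree fs sf
  subvv size_tuple dV leqnn.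
have vX (i : 'I_n.+1) : X`_i = v i by rewrite /= sE // -ltnS.
exists v, (fun j => coord X (inord j)); split.
- move=> i j ilt jlt; have -> : v i = X`_(Ordinal ilt) by rewrite vX.
  rewrite -[LHS]/(coord X (inord j) X`_(Ordinal ilt)) coord_free // -val_eqE /=
    inordK //.
- move=> x; rewrite {1}(coord_basis bX (memvf x)).
  by apply: eq_bigr => i _; rewrite inord_val vX.
- by move=> i; rewrite hv lamE rmorphB.
Qed.

(** * Contracting homotopies *)

Section Cas2.
Variable (F : fieldType).
Implicit Types (X : lmodType F).

(** The value of a bilinear map on twice the Casimir tensor. *)
Definition cas2 X (beta : sl2 F -> sl2 F -> X) : X :=
  beta (sl2E F) (sl2F F) *+ 2 + beta (sl2F F) (sl2E F) *+ 2
  + beta (sl2H F) (sl2H F).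

Lemma cas2D X (b1 b2 : sl2 F -> sl2 F -> X) :
  cas2 (fun a b => b1 a b + b2 a b) = cas2 b1 + cas2 b2.
Proof. by rewrite /cas2 !mulr2n; abel. Qed.

Lemma cas2N X (b1 : sl2 F -> sl2 F -> X) :
  cas2 (fun a b => - b1 a b) = - cas2 b1.
Proof. by rewrite /cas2 !mulr2n; abel. Qed.

Lemma cas2B X (b1 b2 : sl2 F -> sl2 F -> X) :
  cas2 (fun a b => b1 a b - b2 a b) = cas2 b1 - cas2 b2.
Proof. by rewrite /cas2 !mulr2n; abel. Qed.

Lemma cas2_lin (X Y : lmodType F) (k : {linear X -> Y})
    (beta : sl2 F -> sl2 F -> X) :
  k (cas2 beta) = cas2 (fun a b => k (beta a b)).
Proof. by rewrite /cas2 !mulr2n !linearD. Qed.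

Lemma eq_cas2 X (b1 b2 : sl2 F -> sl2 F -> X) :
  (forall a b, b1 a b = b2 a b) -> cas2 b1 = cas2 b2.
Proof. by move=> E; rewrite /cas2 !E. Qed.

Lemma cas2_0 X : cas2 (fun _ _ => 0 : X) = 0.
Proof. by rewrite /cas2 !mul0rn !addr0. Qed.

Lemma cas2_app T X (beta : sl2 F -> sl2 F -> T -> X) s :
  cas2 beta s = cas2 (fun a b => beta a b s).
Proof. by rewrite /cas2 !mulr2n. Qed.

(** Invariance of the Casimir tensor, from which come all the cancellations in
    the homotopy formulas. *)
Lemma cas2_invar X (beta : sl2 F -> sl2 F -> X) x :
    (forall b, linear (beta^~ b)) -> (forall a, linear (beta a)) ->
  cas2 (fun a b => beta (lie a x) b) = - cas2 (fun a b => beta a (lie b x)).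
Proof.
move=> bl br; apply/eqP; rewrite -subr_eq0 opprK -cas2D; apply/eqP.
have bDl a a' b : beta (a + a') b = beta a b + beta a' b.
  by have := bl b 1 a a'; rewrite !scale1r.
have bDr a b b' : beta a (b + b') = beta a b + beta a b'.
  by have := br a 1 b b'; rewrite !scale1r.
have b0l b : beta 0 b = 0 by apply: (addrI (beta 0 b)); rewrite -bDl !addr0.
have b0r a : beta a 0 = 0 by apply: (addrI (beta a 0)); rewrite -bDr !addr0.
have bZl c a b : beta (c *: a) b = c *: beta a b.
  by have := bl b c a 0; rewrite b0l !addr0.
have bZr c a b : beta a (c *: b) = c *: beta a b.
  by have := br a c b 0; rewrite b0r !addr0.
have bNl a b : beta (- a) b = - beta a b by rewrite -[- a]scaleN1r bZl scaleN1r.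
have bNr a b : beta a (- b) = - beta a b by rewrite -[- b]scaleN1r bZr scaleN1r.
have lN (a b : sl2 F) : lie a b = - lie b a := lieC a b.
rewrite (sl2_decomp x) /cas2.
rewrite !linearD !linearZ /= !liexx (lN (sl2F F) (sl2E F)).
rewrite (lN (sl2F F) (sl2H F)) (lN (sl2E F) (sl2H F)) lie_EF lie_HE lie_HF.
rewrite !(mulr2n, opprK, scaler0, addr0, add0r, bDl, bDr, bZl, bZr, bNl, bNr).
rewrite !(b0l, b0r, scalerDr, scalerN, scaler0); abel.
Qed.

End Cas2.

Section SplitExtension.
Variables (F : fieldType) (V : lmodType F) (rho : lieRep (sl2 F) V).
Local Notation g := (semidirect rho : lieAlgType F).

Definition inS (x : sl2 F) : g := (x, 0).
Definition inV (v : V) : g := (0, v).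

Lemma inS_linear : linear inS.
Proof. by move=> a x y; congr pair; rewrite /= scaler0 addr0. Qed.
HB.instance Definition _ := GRing.isLinear.Build F _ _ _ inS inS_linear.

Lemma inV_linear : linear inV.
Proof. by move=> a x y; congr pair; rewrite /= scaler0 addr0. Qed.
HB.instance Definition _ := GRing.isLinear.Build F _ _ _ inV inV_linear.

Lemma split_g (z : g) : z = inS z.1 + inV z.2.
Proof. by case: z => x v; rewrite -[RHS]/(x + 0, 0 + v) addr0 add0r. Qed.

Definition adV x (z : g) : g := inV (rho x z.2).
Definition adS x (z : g) : g := inS (lie x z.1).
Definition projV (z : g) : g := inV z.2.

Lemma adV_linear x : linear (adV x).
Proof.
by move=> a z z'; rewrite -[LHS]/(inV (rho x (a *: z.2 + z'.2))) !linearP.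
Qed.
HB.instance Definition _ x := GRing.isLinear.Build F _ _ _ (adV x) (adV_linear x).

Lemma adS_linear x : linear (adS x).
Proof.
by move=> a z z'; rewrite -[LHS]/(inS (lie x (a *: z.1 + z'.1))) !linearP.
Qed.
HB.instance Definition _ x := GRing.isLinear.Build F _ _ _ (adS x) (adS_linear x).

Lemma projV_linear : linear projV.
Proof. by move=> a z z'; rewrite -[LHS]/(inV (a *: z.2 + z'.2)) linearP. Qed.
HB.instance Definition _ := GRing.isLinear.Build F _ _ _ projV projV_linear.

Lemma lie_inS x (z : g) : lie (inS x) z = adS x z + adV x z.
Proof.
case: z => y v; rewrite -[LHS]/(lie x y, rho x v - rho y 0).
by rewrite -[RHS]/(lie x y + 0, 0 + rho x v) linear0 subr0 addr0 add0r.
Qed.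

Lemma lie_inSS x y : lie (inS x) (inS y) = inS (lie x y).
Proof. by rewrite lie_inS /adS /adV /= !linear0 addr0. Qed.

Lemma lie_inSV x v : lie (inS x) (inV v) = inV (rho x v).
Proof. by rewrite lie_inS /adS /adV /= !linear0 add0r. Qed.

Lemma lie_inV v (z : g) : lie (inV v) z = - inV (rho z.1 v).
Proof.
case: z => y w; rewrite lieC -[lie _ _]/(lie y 0, rho y v - rho 0 w).
by rewrite linear0 rep0l subr0.
Qed.

Variables (M : lmodType F) (tau : lieRep g M).
Implicit Types (f : seq g -> M).

(** The action on C(V, M) when cochains of [g] are read as cochains of [sl2] with
    values in C(V, M). *)
Definition theta x := act (adV x) (tau (inS x)).
HB.instance Definition _ x := GRing.Linear.on (theta x).

(** The coadjoint action on the arguments in [sl2]. *)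
Definition alpha x : (seq g -> M) -> seq g -> M := act (adS x) \0.
HB.instance Definition _ x := GRing.Linear.on (alpha x).

Lemma form_theta x f : form f -> form (theta x f).
Proof. exact: form_act. Qed.

Lemma lieder_inS x f : form f -> lieder tau (inS x) f = theta x f + alpha x f.
Proof.
move=> ff; rewrite -[theta x f]scale1r; apply: act_linearl => // [z|m].
  by rewrite scale1r lie_inS addrC.
by rewrite scale1r addr0.
Qed.

Lemma theta_linear f : form f -> linear (theta^~ f).
Proof.
move=> ff a x y; apply: act_linearl => // [z|m].
  by rewrite /adV repDl repZl linearP.
by rewrite linearP repDl repZl.
Qed.

Lemma alpha_linear f : form f -> linear (alpha^~ f).
Proof.
move=> ff a x y; apply: act_linearl => // [z|m]; last by rewrite /= scaler0 addr0.
by rewrite /adS lie_linearl linearP.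
Qed.

Lemma theta_comm x y f : form f ->
  theta x (theta y f) - theta y (theta x f) = theta (lie x y) f.
Proof.
move=> ff; apply: act_comm => // [z|m].
  by rewrite /adV /= rep_lie linearB.
by rewrite -lie_inSS rep_lie.
Qed.

Lemma alpha_comm x y f : form f ->
  alpha x (alpha y f) - alpha y (alpha x f) = alpha (lie x y) f.
Proof.
move=> ff; apply: act_comm => // [z|m]; last by rewrite /= subr0.
by rewrite /adS /= adjoint_lie linearB.
Qed.

Lemma theta_alpha x y f : form f -> theta x (alpha y f) = alpha y (theta x f).
Proof.
move=> ff; apply/eqP; rewrite -subr_eq0; apply/eqP.
rewrite -[RHS](act0 ff); apply: act_comm => // [z|m].
  by rewrite /adV /adS /= !linear0 addr0.
by rewrite /= linear0 subr0.
Qed.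

Lemma lieder_theta x y f : form f ->
  lieder tau (inS x) (theta y f) - theta y (lieder tau (inS x) f) =
  theta (lie x y) f.
Proof.
move=> ff; rewrite !lieder_inS //; last exact: form_theta.
rewrite (linearD (theta y)) /= -theta_alpha // opprD addrACA subrr addr0;
  exact: theta_comm.
Qed.

Lemma ins_theta_S x y f :
  form f -> ins (inS y) (theta x f) = theta x (ins (inS y) f).
Proof.
move=> ff; have E : adV x (inS y) = 0 by rewrite /adV /= !linear0.
by rewrite [LHS]ins_act E ins0l // subr0.
Qed.

Lemma ins_theta_V x v f :
  ins (inV v) (theta x f) = theta x (ins (inV v) f) - ins (inV (rho x v)) f.
Proof. by []. Qed.

Lemma ins_alpha_V x v f :
  form f -> ins (inV v) (alpha x f) = alpha x (ins (inV v) f).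
Proof.
move=> ff; have E : adS x (inV v) = 0 by rewrite /adS /= !linear0.
by rewrite [LHS]ins_act E ins0l // subr0.
Qed.

Definition casimir_theta f := cas2 (fun a b => theta a (theta b f)).

(** The usual homotopy for the Casimir operator of the coefficients, in the
    cohomology of a semisimple Lie algebra. *)
Definition htheta f := cas2 (fun a b => theta a (ins (inS b) f)).

Definition hlie f := cas2 (fun a b => lieder tau (inS a) (ins (inS b) f)).
Definition casimir_lie f :=
  cas2 (fun a b => lieder tau (inS a) (lieder tau (inS b) f)).

Lemma cas2_linear (G : sl2 F -> sl2 F -> {linear (seq g -> M) -> (seq g -> M)}) :
  linear (fun f => cas2 (fun a b => G a b f)).
Proof.
move=> c f f'; rewrite /cas2 !linearP /= !mulr2n !scalerDr; abel.
Qed.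

Lemma casimir_theta_linear : linear casimir_theta.
Proof. exact: (cas2_linear (fun a b => theta a \o theta b)). Qed.
HB.instance Definition _ := GRing.isLinear.Build F _ _ _ casimir_theta
  casimir_theta_linear.

Lemma htheta_linear : linear htheta.
Proof. exact: (cas2_linear (fun a b => theta a \o ins (inS b))). Qed.
HB.instance Definition _ := GRing.isLinear.Build F _ _ _ htheta htheta_linear.

Lemma hlie_linear : linear hlie.
Proof. exact: (cas2_linear (fun a b => lieder tau (inS a) \o ins (inS b))). Qed.
HB.instance Definition _ := GRing.isLinear.Build F _ _ _ hlie hlie_linear.

Lemma casimir_lie_linear : linear casimir_lie.
Proof. exact: (cas2_linear (fun a b => lieder tau (inS a) \o lieder tau (inS
  b))). Qed.
HB.instance Definition _ := GRing.isLinear.Build F _ _ _ casimir_lie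
  casimir_lie_linear.

Lemma form_cas2 (G : sl2 F -> sl2 F -> seq g -> M) :
  (forall a b, form (G a b)) -> form (cas2 G).
Proof. by move=> fG; rewrite /cas2 !mulr2n; do ![apply: formD|exact: fG]. Qed.

Lemma form_htheta f : form f -> form (htheta f).
Proof. by move=> ff; apply: form_cas2 => a b; apply/form_theta/form_ins. Qed.

Lemma form_casimir_theta f : form f -> form (casimir_theta f).
Proof. by move=> ff; apply: form_cas2 => a b; apply/form_theta/form_theta. Qed.

Lemma form_hlie f : form f -> form (hlie f).
Proof. by move=> ff; apply: form_cas2 => a b; apply/form_lieder/form_ins. Qed.

(** Cartan's homotopy formula, summed against the Casimir tensor. *)
Lemma ced_hlie f : form f -> ced tau (hlie f) + hlie (ced tau f) = casimir_lie f.
Proof.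
move=> ff; rewrite /hlie /casimir_lie cas2_lin /= -cas2D; apply: eq_cas2 => a b.
rewrite -lieder_ced; last exact: form_ins.
by rewrite -linearD /= ins_ced addrC subrK.
Qed.

(** The failure of [theta] to be equivariant under Lie derivatives along [V], see
    [lieder_inV_theta]. *)
Definition twist v (a : sl2 F) (w : g) : g := inV (rho (lie a w.1) v).

Lemma lieder_inV_theta v a f : form f ->
  lieder tau (inV v) (theta a f) - theta a (lieder tau (inV v) f)
    + lieder tau (inV (rho a v)) f = act (twist v a) (fun=> 0) f.
Proof.
move=> ff.
have -> : lieder tau (inV v) (theta a f) - theta a (lieder tau (inV v) f) =
    act (fun w : g => twist v a w - lie (inV (rho a v)) w)
        (fun m => - tau (inV (rho a v)) m) f.
  apply: act_comm => // [w|m].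
    have -> : lie (inV v) (adV a w) = 0.
      by rewrite lie_inV [X in inV X]rep0l linear0 ?oppr0.
    have -> : adV a (lie (inV v) w) = - inV (rho a (rho w.1 v)).
      by rewrite lie_inV linearN.
    rewrite lie_inV /twist rep_lie linearB; abel.
  by rewrite -rep_lie lieC lie_inSV repNl.
apply/esym; rewrite -[X in X + _]scale1r; apply: act_linearl => // [w|m].
  by rewrite scale1r subrK.
by rewrite scale1r addNr.
Qed.

(** Taking the interior product by [w] exchanges the two terms, up to
    antisymmetry and the invariance of the Casimir tensor. *)
Lemma cas2_twist v f : form f ->
  cas2 (fun a b => act (twist v a) (fun=> 0) (ins (inS b) f)
          - ins (inV (rho a v)) (alpha b f)) = 0.
Proof.
move: f; apply: (@form_ind0 _ _ _ _ (-1)) => [f ff|f w ff].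
  have E a b : (act (twist v a) (fun=> 0) (ins (inS b) f)
      - ins (inV (rho a v)) (alpha b f)) [::] = 0.
    by rewrite ins_alpha_V //; exact: subr0.
  by rewrite cas2_app (eq_cas2 E) cas2_0.
have ffS b := form_ins (inS b) ff; have ffV a := form_ins (inV (rho a v)) ff.
have step a b : ins w (act (twist v a) (fun=> 0) (ins (inS b) f)
      - ins (inV (rho a v)) (alpha b f)) =
    - (act (twist v a) (fun=> 0) (ins (inS b) (ins w f))
      - ins (inV (rho a v)) (alpha b (ins w f)))
    - (ins (inV (rho (lie a w.1) v)) (ins (inS b) f)
      + ins (inV (rho a v)) (ins (inS (lie b w.1)) f)).
  rewrite linearB /= ins_act !ins_alpha_V //; last exact: form_ins.
  rewrite [ins w (alpha _ _)]ins_act.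
  rewrite (insC w (inS b) ff) (insC w (inV _) ff) (insC (adS b w) _ ff) !linearN /=.
  have -> : act (twist v a) (fun=> 0) (- ins (inS b) (ins w f)) =
      - act (twist v a) (fun=> 0) (ins (inS b) (ins w f)).
    exact: (linearN (act (twist v a) \0)).
  rewrite /twist /adS; abel.
rewrite scaleN1r -cas2N cas2_lin.
rewrite (eq_cas2 step) cas2B cas2N -[RHS]subr0; congr (_ - _).
rewrite cas2D (cas2_invar (beta := fun a b => ins (inV (rho a v)) (ins (inS b) f))).
- by rewrite addNr.
- move=> b c x y /=; rewrite repDl repZl linearP insP //; exact: form_ins.
- by move=> a c x y; rewrite linearP insP // linearP.
Qed.

Lemma ins_htheta_S x f :
  form f -> ins (inS x) (htheta f) = - htheta (ins (inS x) f).
Proof.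
move=> ff; rewrite /htheta cas2_lin -cas2N; apply: eq_cas2 => a b.
by rewrite [LHS]ins_theta_S ?(insC _ (inS b)) ?linearN //; exact: form_ins.
Qed.

Lemma ins_htheta_V v f : form f ->
  ins (inV v) (htheta f) = - htheta (ins (inV v) f)
    - cas2 (fun a b => ins (inV (rho a v)) (ins (inS b) f)).
Proof.
move=> ff; rewrite /htheta cas2_lin -cas2N -cas2B; apply: eq_cas2 => a b.
by rewrite [LHS]ins_theta_V (insC _ (inS b)) // linearN.
Qed.

Lemma lieder_htheta_S x f : form f ->
  lieder tau (inS x) (htheta f) = htheta (lieder tau (inS x) f).
Proof.
move=> ff; apply/eqP; rewrite -subr_eq0; apply/eqP.
rewrite /htheta cas2_lin -cas2B /=.
have step a b : lieder tau (inS x) (theta a (ins (inS b) f))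
      - theta a (ins (inS b) (lieder tau (inS x) f)) =
    - (theta (lie a x) (ins (inS b) f) + theta a (ins (inS (lie b x)) f)).
  have E := lieder_theta x a (form_ins (inS b) ff).
  move/eqP: E; rewrite subr_eq => /eqP ->.
  rewrite ins_lieder lie_inSS (linearB (theta a)) /=.
  have -> : theta (lie x a) (ins (inS b) f) = - theta (lie a x) (ins (inS b) f).
    rewrite lieC -scaleN1r.
    have := theta_linear (form_ins (inS b) ff) (-1) (lie a x) 0.
    rewrite addr0 => ->; rewrite scaleN1r.
    rewrite [theta 0 _](_ : _ = 0) ?addr0 //.
    rewrite -[RHS](act0 (form_ins (inS b) ff)).
    apply: act_ext => z; first by rewrite /adV rep0l linear0.
    by rewrite linear0 rep0l.
  rewrite [lie x b]lieC linearN insNl // linearN opprK; abel.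
rewrite (eq_cas2 step) cas2N cas2D.
rewrite (cas2_invar (beta := fun a b => theta a (ins (inS b) f))).
- by rewrite addNr oppr0.
- by move=> b; apply/theta_linear/form_ins.
- by move=> a c y z; rewrite linearP insP // linearP.
Qed.

Lemma lieder_htheta_V v f : form f ->
  lieder tau (inV v) (htheta f) = htheta (lieder tau (inV v) f)
   + cas2 (fun a b => act (twist v a) (fun=> 0) (ins (inS b) f))
   - cas2 (fun a b => lieder tau (inV (rho a v)) (ins (inS b) f))
   - cas2 (fun a b => theta a (ins (inV (rho b v)) f)).
Proof.
move=> ff; rewrite /htheta cas2_lin -cas2D -!cas2B; apply: eq_cas2 => a b /=.
rewrite -(lieder_inV_theta v a (form_ins (inS b) ff)).
rewrite ins_lieder lie_inV insNl // opprK (linearD (theta a)) /=; abel.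
Qed.

Lemma ced_cas2_V v f : form f ->
  ced tau (cas2 (fun a b => ins (inV (rho a v)) (ins (inS b) f))) =
  cas2 (fun a b => ins (inV (rho a v)) (ins (inS b) (ced tau f)))
  + cas2 (fun a b => lieder tau (inV (rho a v)) (ins (inS b) f))
  - cas2 (fun a b => ins (inV (rho a v)) (lieder tau (inS b) f)).
Proof.
move=> ff; rewrite cas2_lin -cas2D -cas2B; apply: eq_cas2 => a b /=.
rewrite ins_ced linearB /=.
have -> u w : ced tau (ins u (ins w f)) =
    lieder tau u (ins w f) - ins u (ced tau (ins w f)).
  by rewrite ins_ced; abel.
abel.
Qed.

(** Both sides are compared after an interior product by [z]. For [z] in [sl2]
    all operators are equivariant; for [z] in [V] the defects of equivariance
    add up to the sum that vanishes by [cas2_twist]. *)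
Lemma ced_htheta f : form f ->
  ced tau (htheta f) + htheta (ced tau f) = casimir_theta f.
Proof.
move=> ff; apply/eqP; rewrite -subr_eq0; apply/eqP; move: f ff.
pose P f := ced tau (htheta f) + htheta (ced tau f) - casimir_theta f.
rewrite -/(forall f, form f -> P f = 0).
have PD f1 f2 : P (f1 + f2) = P f1 + P f2.
  have lD (k : (seq g -> M) -> seq g -> M) : linear k ->
      forall a b, k (a + b) = k a + k b.
    by move=> kl a b; have := kl 1 a b; rewrite !scale1r.
  rewrite /P !(lD _ (ced_linear tau), lD _ htheta_linear, lD _
    casimir_theta_linear).
  abel.
have formP' f : form f -> form (P f).
  move=> ff; apply: formB; last exact: form_casimir_theta.
  by apply: formD; [exact/form_ced/form_htheta|exact/form_htheta/form_ced].
have PS x f : form f -> ins (inS x) (P f) = P (ins (inS x) f).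
  move=> ff; rewrite /P linearB linearD /= ins_ced lieder_htheta_S //
    ins_htheta_S //.
  rewrite ins_htheta_S; last exact: form_ced.
  rewrite ins_ced (linearB htheta) (linearN (ced tau)) /=.
  have -> : ins (inS x) (casimir_theta f) = casimir_theta (ins (inS x) f).
    rewrite /casimir_theta cas2_lin; apply: eq_cas2 => a b.
    by rewrite [LHS]ins_theta_S ?ins_theta_S //; exact: form_theta.
  abel.
have PV v f : form f -> ins (inV v) (P f) = P (ins (inV v) f).
  move=> ff; rewrite /P linearB linearD /= ins_ced lieder_htheta_V //
    ins_htheta_V //.
  rewrite ins_htheta_V; last exact: form_ced.
  rewrite (linearB (ced tau)) (linearN (ced tau)) /= ced_cas2_V // ins_ced.
  rewrite (linearB htheta) /=.
  have -> : ins (inV v) (casimir_theta f) = casimir_theta (ins (inV v) f)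
      - cas2 (fun a b => theta a (ins (inV (rho b v)) f))
      - cas2 (fun a b => ins (inV (rho a v)) (theta b f)).
    rewrite /casimir_theta cas2_lin -!cas2B; apply: eq_cas2 => a b /=.
    by rewrite [LHS]ins_theta_V [ins _ (theta b f)]ins_theta_V (linearB (theta a)).
  have -> : cas2 (fun a b => ins (inV (rho a v)) (lieder tau (inS b) f)) =
     cas2 (fun a b => ins (inV (rho a v)) (theta b f)) +
     cas2 (fun a b => ins (inV (rho a v)) (alpha b f)).
    by rewrite -cas2D; apply: eq_cas2 => a b; rewrite lieder_inS.
  have := cas2_twist v ff; rewrite cas2B => /eqP; rewrite subr_eq0 => /eqP ->.
  abel.
apply: (@form_ind0 _ _ _ _ 1) => [f ff|f z ff].
  rewrite /P -[LHS]/(0 + htheta (ced tau f) [::] - casimir_theta f [::]).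
  rewrite add0r /htheta /casimir_theta !cas2_app -cas2B -[RHS](@cas2_0 _ M);
    apply: eq_cas2 => a b.
  rewrite -[theta a _ [::]]/(tau (inS a) (tau (inS b) (f [::]) - 0)) subr0.
  exact: subrr.
by rewrite scale1r (split_g z) !insDl ?PS ?PV ?PD //; exact: formP'.
Qed.

End SplitExtension.

(** * Reduction to the kernel of a null-homotopic operator *)

Section Reduction.
Variable F : fieldType.

(** In finite dimension the second condition makes [U] the direct sum of the
    kernel and of the image of [O] ([split_decomp]). *)
Definition split_at (W : vectType F) (O : 'End(W)) (U : {vspace W}) : Prop :=
  (forall u, u \in U -> O u \in U) /\
  (forall u, u \in U -> O (O u) = 0 -> O u = 0).

Lemma split_decomp (W : vectType F) (O : 'End(W)) (U : {vspace W}) u :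
    split_at O U -> u \in U ->
  exists u0 u1, [/\ u0 \in U, u1 \in U, O u0 = 0 & u = u0 + O u1].
Proof.
move=> [OU OO] uU.
have OUU : (O @: U <= U)%VS by apply/subvP => _ /memv_imgP[x xU ->]; exact: OU.
have disj : ((U :&: lker O) :&: O @: U = 0)%VS.
  apply/eqP; rewrite -subv0; apply/subvP => x; rewrite !memv_cap memv_ker memv0.
  move=> /andP[/andP[_ /eqP Ox] /memv_imgP[y yU xE]].
  by rewrite xE; apply/eqP/OO => //; rewrite -xE.
have sumE : (U :&: lker O + O @: U)%VS = U.
  apply/eqP; rewrite -dimv_leqif_eq ?dimv_disjoint_sum ?limg_ker_dim //.
  by rewrite subv_add capvSl.
move: uU; rewrite -{1}sumE => /memv_addP[u0]; rewrite memv_cap memv_ker.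
move=> /andP[u0U /eqP Ou0] [_ /memv_imgP[u1 u1U ->] ->].
by exists u0, u1.
Qed.

Variables (A B C : vectType F) (dA : 'Hom(A, B)) (dB : 'Hom(B, C)).
Hypothesis dd : forall a, dB (dA a) = 0.

Section OneStep.
Variables (OA : 'End(A)) (OB : 'End(B)) (OC : 'End(C)).
Variables (hB : 'Hom(B, A)) (hC : 'Hom(C, B)).
Variables (UA : {vspace A}) (UB : {vspace B}) (UC : {vspace C}).
Hypotheses (sA : split_at OA UA) (sB : split_at OB UB) (sC : split_at OC UC).
Hypotheses (dAU : forall a, a \in UA -> dA a \in UB)
           (dBU : forall b, b \in UB -> dB b \in UC)
           (hBU : forall b, b \in UB -> hB b \in UA).
Hypothesis homotopy : forall b, dA (hB b) + hC (dB b) = OB b.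
Hypotheses (OdA : forall a, OB (dA a) = dA (OA a))
           (OdB : forall b, OC (dB b) = dB (OB b)).

(** Write [z] as [z0 + O y] with [y] in the image of [O]. Then [dB y] lies both in
    the kernel and in the image, so it vanishes, and [O y] is the coboundary of
    [hB y]. *)
Lemma cocycle_reduction z : z \in UB -> dB z = 0 ->
  exists z0 a, [/\ z0 \in UB, a \in UA, OB z0 = 0 & z = z0 + dA a].
Proof.
move=> zU dz; have [z0 [u [z0U uU Oz0 zE]]] := split_decomp sB zU.
have [u0 [w [u0U wU Ou0 uE]]] := split_decomp sB uU.
have OuE : OB u = OB (OB w) by rewrite uE linearD /= Ou0 add0r.
have OCw : OC (dB w) = 0.
  have dwU := dBU wU; have OdwU := sC.1 _ dwU.
  apply: sC.2 => //; apply: sC.2 => //.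
  have : OC (dB z) = 0 by rewrite dz linear0.
  by rewrite zE linearD /= linearD /= OdB Oz0 linear0 add0r OuE -!OdB.
exists z0, (hB (OB w)); split=> //; first by apply/hBU/sB.1.
by rewrite zE OuE -[OB (OB w)]homotopy -OdB OCw linear0 addr0.
Qed.

Lemma coboundary_reduction a : a \in UA -> OB (dA a) = 0 ->
  exists a0, [/\ a0 \in UA, OA a0 = 0 & dA a = dA a0].
Proof.
move=> aU Oda; have [a0 [a1 [a0U a1U Oa0 aE]]] := split_decomp sA aU.
exists a0; split=> //; rewrite aE linearD /= -OdA.
have -> : OB (dA a1) = 0; last by rewrite addr0.
apply: sB.2; first exact: dAU.
by move: Oda; rewrite aE linearD /= linearD /= !OdA Oa0 linear0 add0r.
Qed.

End OneStep.

(** The second reduction takes place inside the kernel of the first operator. If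
    the differentials vanish on the common kernel, this common kernel is a
    complement of the coboundaries in the cocycles. *)
Lemma two_step_dim (OA PA : 'End(A)) (OB PB : 'End(B)) (OC PC : 'End(C))
    (hB kB : 'Hom(B, A)) (hC kC : 'Hom(C, B)) :
    split_at OA fullv -> split_at OB fullv -> split_at OC fullv ->
    split_at PA (lker OA) -> split_at PB (lker OB) -> split_at PC (lker OC) ->
    (forall b, b \in lker OB -> kB b \in lker OA) ->
    (forall b, dA (hB b) + hC (dB b) = OB b) ->
    (forall b, dA (kB b) + kC (dB b) = PB b) ->
    (forall a, OB (dA a) = dA (OA a)) -> (forall b, OC (dB b) = dB (OB b)) ->
    (forall a, PB (dA a) = dA (PA a)) -> (forall b, PC (dB b) = dB (PB b)) ->
    (forall a, OA a = 0 -> PA a = 0 -> dA a = 0) ->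
    (forall b, OB b = 0 -> PB b = 0 -> dB b = 0) ->
  (limg dA <= lker dB)%VS /\
  \dim (lker dB) = (\dim (limg dA) + \dim (lker OB :&: lker PB))%N.
Proof.
move=> sOA sOB sOC sPA sPB sPC kBK hO hP OdA OdB PdA PdB dA0 dB0.
have dAK a : a \in lker OA -> dA a \in lker OB.
  by rewrite !memv_ker OdA => /eqP ->; rewrite linear0.
have dBK b : b \in lker OB -> dB b \in lker OC.
  by rewrite !memv_ker OdB => /eqP ->; rewrite linear0.
have le : (limg dA <= lker dB)%VS.
  by apply/subvP => _ /memv_imgP[a _ ->]; rewrite memv_ker dd.
split=> //; rewrite -dimv_disjoint_sum.
  congr (\dim _); apply/eqP; rewrite eqEsubv subv_add le /=; apply/andP; split.
    apply/subvP => z; rewrite memv_ker => /eqP dz.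
    have [z0 [a [_ _ Oz0 zE]]] := cocycle_reduction sOB sOC (fun b _ => memvf _)
      (fun b _ => memvf _) hO OdB (memvf z) dz.
    have z0K : z0 \in lker OB by rewrite memv_ker Oz0.
    have dz0 : dB z0 = 0 by move: dz; rewrite zE linearD /= dd addr0.
    have [z1 [a' [z1K _ Pz1 z0E]]] := cocycle_reduction sPB sPC dBK kBK hP PdB
      z0K dz0.
    rewrite zE z0E -addrA -linearD addrC; apply: memv_add.
      exact: memv_img (memvf _).
    by rewrite memv_cap z1K memv_ker Pz1 eqxx.
  apply/subvP => b; rewrite memv_cap !memv_ker => /andP[/eqP Ob /eqP Pb].
  by apply/eqP/dB0.
apply/eqP; rewrite -subv0; apply/subvP => z; rewrite !memv_cap !memv_ker memv0.
move=> /andP[/memv_imgP[a _ zE] /andP[/eqP Oz /eqP Pz]].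
rewrite zE in Oz Pz *.
have [a0 [_ Oa0 dE]] := coboundary_reduction sOA sOB (fun a _ => memvf _) OdA
  (memvf a) Oz.
have a0K : a0 \in lker OA by rewrite memv_ker Oa0.
rewrite dE in Pz *.
have [a1 [a1K Pa1 ->]] := coboundary_reduction sPA sPB dAK PdA a0K Pz.
by apply/eqP/dA0 => //; apply/eqP; rewrite -memv_ker.
Qed.

End Reduction.

(** * Dimensions of coordinate subspaces *)

Lemma dim_support (F : fieldType) (I : finType) (P : pred I)
    (U : {vspace {ffun I -> F^o}}) :
    (forall w, (w \in U) = [forall i, ~~ P i ==> (w i == 0)]) ->
  \dim U = #|P|.
Proof.
move=> UE.
pose r (w : {ffun I -> F^o}) : {ffun {i | P i} -> F^o} := [ffun i => w (val i)].
have r_lin : linear r by move=> a w w'; apply/ffunP => i; rewrite !ffunE.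
pose rL : {linear {ffun I -> F^o} -> {ffun {i | P i} -> F^o}} :=
  HB.pack r (GRing.isLinear.Build _ _ _ _ r r_lin).
rewrite -(limg_ker_dim (linfun rL) U).
have -> : (U :&: lker (linfun rL) = 0)%VS.
  apply/eqP; rewrite -subv0; apply/subvP => w; rewrite memv_cap memv_ker UE memv0.
  rewrite lfunE /= => /andP[/forallP w0 /eqP rw]; apply/eqP/ffunP => i.
  rewrite [RHS]ffunE; have [Pi|nPi] := boolP (P i); last first.
    by apply/eqP; have := w0 i; rewrite nPi.
  by have := congr1 (fun u : {ffun {i | P i} -> F^o} => u (exist _ i Pi)) rw;
    rewrite !ffunE.
rewrite dimv0 add0n.
have -> : (linfun rL @: U)%VS = fullv.
  apply/eqP; rewrite eqEsubv subvf /=; apply/subvP => u _.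
  pose w : {ffun I -> F^o} := [ffun i => if insub i is Some j then u j else 0].
  have -> : u = linfun rL w.
    by rewrite lfunE /=; apply/ffunP => i; rewrite !ffunE valK.
  apply: memv_img; rewrite UE; apply/forallP => i; apply/implyP => nPi.
  by rewrite ffunE insubN.
rewrite dimvf /dim /= card_sig muln1.
by [].
Qed.

Lemma card_seq_sub_count (T : choiceType) (s : seq T) (P : pred T) :
  uniq s -> #|[pred p : seq_sub s | P (ssval p)]| = count P s.
Proof.
move=> us; rewrite cardE -size_filter -(size_map (@ssval T s)).
apply: perm_size; apply: uniq_perm.
- by rewrite map_inj_uniq ?enum_uniq //; exact: val_inj.
- exact: filter_uniq.
move=> x; rewrite mem_filter; apply/mapP/andP => [[p]|[Px xs]].
  by rewrite mem_enum inE => Pp ->; split=> //; exact: ssvalP.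
by exists (SeqSub xs) => //; rewrite mem_enum inE.
Qed.

(** * Quotients and isomorphisms of modules *)

Section QuotLemmas.
Local Open Scope quotient_scope.
Variables (F : fieldType) (V : lmodType F) (I : submodClosed V).

Lemma quot_mod_eq (u v : V) :
  (\pi_(quot_mod I) u == \pi_(quot_mod I) v) = (u - v \in I).
Proof. by rewrite -(Quotient.idealrBE (in_submod I)) inE. Qed.

Lemma quot_mod_eq0 (u : V) : u \in I -> \pi_(quot_mod I) u = 0 :> quot_mod I.
Proof.
move=> uI; apply: (addrI (\pi_(quot_mod I) 0 : quot_mod I)).
rewrite -pi_quotD addr0 add0r; apply/eqP.
by rewrite quot_mod_eq subr0.
Qed.

Lemma quot_mod_line (z : V) :
    z \notin I -> (forall u, exists a, u - a *: z \in I) ->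
  lmod_iso (quot_mod I : lmodType F) F^o.
Proof.
move=> zI gen.
pose f (a : F^o) : quot_mod I := (a : F) *: (\pi_(quot_mod I) z : quot_mod I).
have f_lin : linear f by move=> a b c; rewrite /f scalerDl scalerA.
pose fL : {linear F^o -> quot_mod I} := HB.pack f (GRing.isLinear.Build _ _ _ _
  f f_lin).
have fE a : f a = \pi_(quot_mod I) (a *: z) by rewrite pi_quotZ.
have f_inj : injective f.
  move=> a b; rewrite !fE => /eqP; rewrite quot_mod_eq -scalerBl => abz.
  apply/eqP; rewrite -subr_eq0; apply: contraNT zI => ab.
  by rewrite -[z](scalerK ab) rpredZ.
have f_surj (c : quot_mod I) : exists a, f a = c.
  elim/quotW: c => u; have [a au] := gen u; exists a.
  by rewrite fE; apply/eqP; rewrite eq_sym quot_mod_eq.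
pose h c := projT1 (cid (f_surj c)).
have hK : cancel h f by move=> c; exact: projT2 (cid (f_surj c)).
have fK : cancel f h by move=> a; apply: f_inj; rewrite hK.
have h_lin : linear h by exact: (can2_linear (f := fL) fK hK).
pose hL : {linear quot_mod I -> F^o} := HB.pack h (GRing.isLinear.Build _ _ _ _
  h h_lin).
by exists hL; exists f.
Qed.

End QuotLemmas.

(** * Weights *)

Definition weight (t : nat -> int) (l : seq nat) : int :=
  foldr (fun i a => t i + a) 0 l.

Lemma act_diag (F : fieldType) (g M : lmodType F) n (b : nat -> g)
    (t : nat -> int) (T : g -> g) (B : M -> M) (f : seq g -> M) l :
    (forall i, (i < n)%N -> T (b i) = (t i)%:~R *: b i) ->
    form f -> all (gtn n) l ->
  act T B f (map b l) = B (f (map b l)) - (weight t l)%:~R *: f (map b l).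
Proof.
move=> Tb; elim: l f => [|i l IH] f ff /=; first by rewrite scale0r subr0.
move=> /andP[ni nl]; rewrite IH ?Tb //; last exact: form_ins.
rewrite -[f (_ *: _ :: _)]/(ins _ f (map b l)) insZl // fctE.
rewrite rmorphD scalerDl /ins; abel.
Qed.

Lemma diag_integral_weights (F : numFieldType) (I : finType)
    (h : 'End({ffun I -> F^o})) (lam : I -> int) :
    (forall w i, h w i = (lam i)%:~R * w i) ->
  integral_weights h [seq c <- map lam (enum I) | c != 0].
Proof.
move=> hE; split; first by rewrite mem_filter eqxx.
move=> w; apply/ffunP => i; rewrite [RHS]ffunE.
set ws := filter _ _.
have E : foldr (fun c v => h v - c%:~R *: v) (h w) ws i =
    (\prod_(c <- ws) (lam i - c)%:~R) * ((lam i)%:~R * w i).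
  elim: (ws) => [|c cs IH] /=; first by rewrite big_nil mul1r hE.
  rewrite !ffunE hE IH big_cons rmorphB /= -[_ *: _]/(_ * _); ring.
rewrite E; have [->|li] := eqVneq (lam i) 0; first by rewrite mul0r mulr0.
rewrite (_ : \prod_(c <- ws) _ = 0) ?mul0r //; apply/eqP.
rewrite prodf_seq_eq0; apply/hasP; exists (lam i); last by rewrite /= subrr mulr0z.
by rewrite mem_filter li map_f // mem_enum.
Qed.

Lemma family_triple (F : numFieldType) (W : lmodType F)
    (R : sl2 F -> {linear W -> W}) :
    (forall w, linear (fun x => R x w)) ->
    (forall x y w, R x (R y w) - R y (R x w) = R (lie x y) w) ->
  sl2_triple (R (sl2E F)) (R (sl2F F)) (R (sl2H F)).
Proof.
move=> Rl RR.
have RD x y w : R (x + y) w = R x w + R y w.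
  by have := Rl w 1 x y; rewrite !scale1r.
have RN x w : R (- x) w = - R x w.
  have := RD x (- x) w; rewrite subrr.
  have -> : R 0 w = 0 by apply: (addrI (R 0 w)); rewrite -RD !addr0.
  by move/esym/eqP; rewrite addrC addr_eq0 => /eqP.
split=> w.
- by rewrite -lie_EF -RR addrC subrK.
- by rewrite mulr2n -RD -mulr2n -lie_HE -RR addrC subrK.
- by rewrite mulr2n -RD -RN -mulr2n -lie_HF -RR addrC subrK.
Qed.

Lemma family_invariant (F : numFieldType) (U : lmodType F)
    (R : sl2 F -> {linear U -> U}) w :
    (forall w, linear (fun x => R x w)) ->
    R (sl2E F) w = 0 -> R (sl2F F) w = 0 -> R (sl2H F) w = 0 ->
  forall x, R x w = 0.
Proof.
move=> Rl eE eF eH x.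
have RD y z : R (y + z) w = R y w + R z w.
  by have := Rl w 1 y z; rewrite !scale1r.
have R0 : R 0 w = 0 by apply: (addrI (R 0 w)); rewrite -RD !addr0.
have RZ a y : R (a *: y) w = a *: R y w.
  by have := Rl w a y 0; rewrite R0 !addr0.
by rewrite (sl2_decomp x) !RD !RZ eE eF eH !scaler0 !addr0.
Qed.

Lemma homog_cas2 (F : fieldType) (g M : lmodType F) k
    (G : sl2 F -> sl2 F -> seq g -> M) :
  (forall a b, homog k (G a b)) -> homog k (cas2 G).
Proof.
move=> hG s sk; rewrite cas2_app (eq_cas2 (b2 := fun _ _ => 0)) ?cas2_0 //.
by move=> a b; exact: hG.
Qed.

Lemma memv_capP (F : fieldType) (U : vectType F) (X Y : {vspace U}) w :
  w \in (X :&: Y)%VS <-> w \in X /\ w \in Y.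
Proof. by rewrite memv_cap; split=> /andP. Qed.

Lemma capv_rot (F : fieldType) (U : vectType F) (X Y Z T : {vspace U}) :
  (X :&: Y :&: Z :&: T = X :&: T :&: Y :&: Z)%VS.
Proof. by rewrite -!capvA; congr (X :&: _)%VS; rewrite [LHS]capvA [LHS]capvC. Qed.

Section Operators.
Variables (F : numFieldType) (V : lmodType F) (rho : lieRep (sl2 F) V).
Local Notation g := (semidirect rho : lieAlgType F).
Variables (v : nat -> V) (cv : nat -> {scalar V}).
Hypothesis cv_v : forall i j, (i < 8)%N -> (j < 8)%N -> cv j (v i) = (i == j)%:R.
Hypothesis sum_cv : forall x, x = \sum_(i < 8) cv i x *: v i.
Hypothesis v_weight : forall i, rho (sl2H F) (v i) = (7 - (i.*2)%:Z)%:~R *: v i.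

Definition bas (i : nat) : g :=
  match i with
  | 0 => inS rho (sl2E F)
  | 1 => inS rho (sl2H F)
  | 2 => inS rho (sl2F F)
  | i'.+3 => inV rho (v i')
  end.

Definition crd (i : nat) (z : g) : F :=
  match i with
  | 0 => z.1 0 1
  | 1 => z.1 0 0
  | 2 => z.1 1 0
  | i'.+3 => cv i' z.2
  end.

Lemma crd_linear i : scalar (crd i).
Proof.
move=> a z z'; case: i => [|[|[|i]]] /=; last exact: linearP.
- by rewrite -[LHS]/((a *: z.1 + z'.1 : sl2 F) 0 1) !mxE.
- by rewrite -[LHS]/((a *: z.1 + z'.1 : sl2 F) 0 0) !mxE.
- by rewrite -[LHS]/((a *: z.1 + z'.1 : sl2 F) 1 0) !mxE.
Qed.

HB.instance Definition _ i := GRing.isLinear.Build F g F _ (crd i) (crd_linear i).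

Definition co (i : nat) : {scalar g} := crd i.

Lemma co_bas i j : (i < 11)%N -> (j < 11)%N -> co j (bas i) = (i == j)%:R.
Proof.
by case: i => [|[|[|i]]]; case: j => [|[|[|j]]] //= ilt jlt;
   rewrite ?mxE ?linear0 //; exact: cv_v.
Qed.

Lemma sum_co_bas (z : g) : z = \sum_(i < 11) co i z *: bas i.
Proof.
transitivity (co 0 z *: bas 0 + (co 1 z *: bas 1 + (co 2 z *: bas 2
    + \sum_(i < 8) co i.+3 z *: bas i.+3))).
  rewrite [LHS]split_g {1}(sl2_decomp z.1) {1}(sum_cv z.2) linear_sum.
  rewrite !linearD !linearZ /= (addrAC (_ *: inS rho (sl2E F))) -!addrA.
  by do 3!congr (_ + _); apply: eq_bigr => i _; rewrite linearZ.
by rewrite 3![in RHS]big_ord_recl; do 3!congr (_ + _); apply: eq_bigr.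
Qed.

Local Notation W k := (cspace F 11 k).
Local Notation phi := (Phi 11 bas co).
Local Notation psi := (@Psi F g 11 bas co _).

Definition degree k k' (P : (seq g -> g) -> (seq g -> g)) : Prop :=
  forall f, form f -> homog k f -> form (P f) /\ homog k' (P f).

Definition coord_op k k' (P : {linear (seq g -> g) -> (seq g -> g)}) :
  'Hom(W k, W k') :=
  linfun (phi k' \o (P \o @Psi F g 11 bas co k)).

Lemma Psi_inj k : injective (@Psi F g 11 bas co k).
Proof. by move=> w w' E; rewrite -(PhiK co_bas w) E (PhiK co_bas). Qed.

Lemma Psi_coord_op k k' (P : {linear (seq g -> g) -> (seq g -> g)}) w :
  degree k k' P -> psi (coord_op k k' P w) = P (psi w).
Proof.
move=> dP; rewrite /coord_op lfunE /=.
have [fP hP] := dP _ (form_Psi bas co w) (homog_Psi bas co w).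
exact: PsiK co_bas sum_co_bas _ _ fP hP.
Qed.

Let tau := adjoint g.

Lemma degree_act k (T B : {linear g -> g}) : degree k k (act T B).
Proof. by move=> f ff hf; split; [exact: form_act|exact: homog_act]. Qed.

Lemma degree_ced k : degree k k.+1 (ced tau).
Proof. by move=> f ff hf; split; [exact: form_ced|exact: homog_ced]. Qed.

Lemma degree_theta k x : degree k k (theta tau x).
Proof. exact: degree_act. Qed.

Lemma degree_alpha k x : degree k k (alpha x).
Proof. exact: degree_act. Qed.

Lemma degree_lieder k x : degree k k (lieder tau x).
Proof. exact: degree_act. Qed.

Lemma degree_htheta k : degree k.+1 k (htheta tau).
Proof.
move=> f ff hf; split; first exact: form_htheta.
by apply: homog_cas2 => a b; apply/homog_act/homog_ins.
Qed.

Lemma degree_hlie k : degree k.+1 k (hlie tau).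
Proof.
move=> f ff hf; split; first exact: form_hlie.
by apply: homog_cas2 => a b; apply/homog_act/homog_ins.
Qed.

Lemma degree_casimir_theta k : degree k k (casimir_theta tau).
Proof.
move=> f ff hf; split; first exact: form_casimir_theta.
by apply: homog_cas2 => a b; apply/homog_act/homog_act.
Qed.

Lemma degree_casimir_lie k : degree k k (casimir_lie tau).
Proof.
move=> f ff hf; split.
  by apply: form_cas2 => a b; apply/form_lieder/form_lieder.
by apply: homog_cas2 => a b; apply/homog_act/homog_act.
Qed.

Definition ced_op k : 'Hom(W k, W k.+1) := coord_op k k.+1 (ced tau).
Definition theta_op k x : 'End(W k) := coord_op k k (theta tau x).
Definition alpha_op k x : 'End(W k) := coord_op k k (alpha (rho := rho) x).
Definition lieder_op k x : 'End(W k) := coord_op k k (lieder tau (inS rho x)).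
Definition euler_op k : 'End(W k) :=
  coord_op k k (act (@projV _ _ rho) (@projV _ _ rho)).
Definition htheta_op k : 'Hom(W k.+1, W k) := coord_op k.+1 k (htheta tau).
Definition hlie_op k : 'Hom(W k.+1, W k) := coord_op k.+1 k (hlie tau).
Definition cas_theta_op k : 'End(W k) := coord_op k k (casimir_theta tau).
Definition cas_lie_op k : 'End(W k) := coord_op k k (casimir_lie tau).

Lemma Psi_ced k (w : W k) : psi (ced_op k w) = ced tau (psi w).
Proof. exact/Psi_coord_op/degree_ced. Qed.
Lemma Psi_theta k x (w : W k) : psi (theta_op k x w) = theta tau x (psi w).
Proof. exact/Psi_coord_op/degree_theta. Qed.
Lemma Psi_alpha k x (w : W k) : psi (alpha_op k x w) = alpha x (psi w).
Proof. exact/Psi_coord_op/degree_alpha. Qed.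
Lemma Psi_lieder k x (w : W k) :
  psi (lieder_op k x w) = lieder tau (inS rho x) (psi w).
Proof. exact/Psi_coord_op/degree_lieder. Qed.
Lemma Psi_euler k (w : W k) :
  psi (euler_op k w) = act (@projV _ _ rho) (@projV _ _ rho) (psi w).
Proof. exact/Psi_coord_op/degree_act. Qed.
Lemma Psi_htheta k (w : W k.+1) : psi (htheta_op k w) = htheta tau (psi w).
Proof. exact/Psi_coord_op/degree_htheta. Qed.
Lemma Psi_hlie k (w : W k.+1) : psi (hlie_op k w) = hlie tau (psi w).
Proof. exact/Psi_coord_op/degree_hlie. Qed.
Lemma Psi_cas_theta k (w : W k) :
  psi (cas_theta_op k w) = casimir_theta tau (psi w).
Proof. exact/Psi_coord_op/degree_casimir_theta. Qed.
Lemma Psi_cas_lie k (w : W k) : psi (cas_lie_op k w) = casimir_lie tau (psi w).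
Proof. exact/Psi_coord_op/degree_casimir_lie. Qed.

Definition PsiE := (Psi_ced, Psi_theta, Psi_alpha, Psi_lieder, Psi_euler,
  Psi_htheta, Psi_hlie, Psi_cas_theta, Psi_cas_lie).

Let fP k (w : W k) : form (psi w) := form_Psi bas co w.

Lemma ced_op_ced_op k (w : W k) : ced_op k.+1 (ced_op k w) = 0.
Proof. by apply: Psi_inj; rewrite !PsiE linear0 ced_ced. Qed.

Lemma ced_htheta_op k (w : W k.+1) :
  ced_op k (htheta_op k w) + htheta_op k.+1 (ced_op k.+1 w) = cas_theta_op k.+1 w.
Proof. by apply: Psi_inj; rewrite linearD /= !PsiE ced_htheta. Qed.

Lemma ced_hlie_op k (w : W k.+1) :
  ced_op k (hlie_op k w) + hlie_op k.+1 (ced_op k.+1 w) = cas_lie_op k.+1 w.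
Proof. by apply: Psi_inj; rewrite linearD /= !PsiE ced_hlie. Qed.

Lemma homog0_htheta (f : seq g -> g) : homog 0 f -> htheta tau f = 0.
Proof.
move=> hf; rewrite /htheta (eq_cas2 (b2 := fun _ _ => 0)) ?cas2_0 // => a b.
by rewrite homog0_ins // linear0.
Qed.

Lemma homog0_hlie (f : seq g -> g) : homog 0 f -> hlie tau f = 0.
Proof.
move=> hf; rewrite /hlie (eq_cas2 (b2 := fun _ _ => 0)) ?cas2_0 // => a b.
by rewrite homog0_ins // linear0.
Qed.

Lemma htheta_ced_op0 (w : W 0) : htheta_op 0 (ced_op 0 w) = cas_theta_op 0 w.
Proof.
have h0 : homog 0 (psi w) by exact: homog_Psi.
by apply: Psi_inj; rewrite !PsiE -ced_htheta // (homog0_htheta h0) linear0 add0r.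
Qed.

Lemma hlie_ced_op0 (w : W 0) : hlie_op 0 (ced_op 0 w) = cas_lie_op 0 w.
Proof.
have h0 : homog 0 (psi w) by exact: homog_Psi.
by apply: Psi_inj; rewrite !PsiE -ced_hlie // (homog0_hlie h0) linear0 add0r.
Qed.

Lemma cas_theta_ced_op k (w : W k) :
  cas_theta_op k.+1 (ced_op k w) = ced_op k (cas_theta_op k w).
Proof.
case: k w => [|k] w; rewrite -ced_htheta_op ced_op_ced_op linear0 addr0
  ?htheta_ced_op0 //.
by rewrite -ced_htheta_op linearD /= ced_op_ced_op add0r.
Qed.

Lemma cas_lie_ced_op k (w : W k) :
  cas_lie_op k.+1 (ced_op k w) = ced_op k (cas_lie_op k w).
Proof.
case: k w => [|k] w; rewrite -ced_hlie_op ced_op_ced_op linear0 addr0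
  ?hlie_ced_op0 //.
by rewrite -ced_hlie_op linearD /= ced_op_ced_op add0r.
Qed.

Lemma lieder_opE k x (w : W k) : lieder_op k x w = theta_op k x w + alpha_op k x w.
Proof. by apply: Psi_inj; rewrite linearD /= !PsiE lieder_inS. Qed.

Lemma theta_alpha_op k x y (w : W k) :
  theta_op k x (alpha_op k y w) = alpha_op k y (theta_op k x w).
Proof. by apply: Psi_inj; rewrite !PsiE theta_alpha. Qed.

Lemma theta_op_comm k x y (w : W k) :
  theta_op k x (theta_op k y w) - theta_op k y (theta_op k x w) =
  theta_op k (lie x y) w.
Proof. by apply: Psi_inj; rewrite linearB /= !PsiE theta_comm. Qed.

Lemma alpha_op_comm k x y (w : W k) :
  alpha_op k x (alpha_op k y w) - alpha_op k y (alpha_op k x w) =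
  alpha_op k (lie x y) w.
Proof. by apply: Psi_inj; rewrite linearB /= !PsiE alpha_comm. Qed.

Lemma lieder_op_comm k x y (w : W k) :
  lieder_op k x (lieder_op k y w) - lieder_op k y (lieder_op k x w) =
  lieder_op k (lie x y) w.
Proof. by apply: Psi_inj; rewrite linearB /= !PsiE lieder_comm // lie_inSS. Qed.

Lemma lieder_theta_op k x y (w : W k) :
  lieder_op k x (theta_op k y w) - theta_op k y (lieder_op k x w) =
  theta_op k (lie x y) w.
Proof. by apply: Psi_inj; rewrite linearB /= !PsiE lieder_theta. Qed.

Lemma theta_op_linear k (w : W k) : linear (fun x => theta_op k x w).
Proof. by move=> a x y; apply: Psi_inj; rewrite linearP /= !PsiE theta_linear. Qed.

Lemma alpha_op_linear k (w : W k) : linear (fun x => alpha_op k x w).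
Proof. by move=> a x y; apply: Psi_inj; rewrite linearP /= !PsiE alpha_linear. Qed.

Lemma lieder_op_linear k (w : W k) : linear (fun x => lieder_op k x w).
Proof.
by move=> a x y; apply: Psi_inj; rewrite linearP /= !PsiE linearP lieder_linearl.
Qed.

Lemma theta_op_triple k :
  sl2_triple (theta_op k (sl2E F)) (theta_op k (sl2F F)) (theta_op k (sl2H F)).
Proof.
exact: (family_triple (R := theta_op k) (@theta_op_linear k) (@theta_op_comm k)).
Qed.

Lemma alpha_op_triple k :
  sl2_triple (alpha_op k (sl2E F)) (alpha_op k (sl2F F)) (alpha_op k (sl2H F)).
Proof.
exact: (family_triple (R := alpha_op k) (@alpha_op_linear k) (@alpha_op_comm k)).
Qed.

Lemma lieder_op_triple k :
  sl2_triple (lieder_op k (sl2E F)) (lieder_op k (sl2F F)) (lieder_op k (sl2H F)).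
Proof.
exact: (family_triple (R := lieder_op k) (@lieder_op_linear k) (@lieder_op_comm k)).
Qed.

Lemma cas_theta_opE k (w : W k) :
  cas_theta_op k w =
  casimir (theta_op k (sl2E F)) (theta_op k (sl2F F)) (theta_op k (sl2H F)) w.
Proof. by apply: Psi_inj; rewrite /casimir !mulr2n !linearD /= !PsiE. Qed.

Lemma cas_lie_opE k (w : W k) :
  cas_lie_op k w =
  casimir (lieder_op k (sl2E F)) (lieder_op k (sl2F F)) (lieder_op k (sl2H F)) w.
Proof. by apply: Psi_inj; rewrite /casimir !mulr2n !linearD /= !PsiE. Qed.

(** Weights of the basis vectors: [wV] for [sl2] acting on [V], [wS] for [sl2]
    acting on itself, [wE] for the Euler derivation. *)
Definition wV (i : nat) : int := if (i < 3)%N then 0 else 13 - (i.*2)%:Z.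
Definition wS (i : nat) : int := if (i < 3)%N then 2 - (i.*2)%:Z else 0.
Definition wE (i : nat) : int := if (i < 3)%N then 0 else 1.

Definition theta_wt (p : seq nat * nat) : int := wV p.2 + wS p.2 - weight wV p.1.
Definition alpha_wt (p : seq nat * nat) : int := - weight wS p.1.
Definition euler_wt (p : seq nat * nat) : int := wE p.2 - weight wE p.1.

Lemma coord_op_diag k (T B : {linear g -> g}) (t u : nat -> int) w
    (p : seq_sub (idx 11 k)) :
    (forall i, (i < 11)%N -> T (bas i) = (t i)%:~R *: bas i) ->
    (forall m z, (m < 11)%N -> co m (B z) = (u m)%:~R * co m z) ->
  coord_op k k (act T B) w p = (u (ssval p).2 - weight t (ssval p).1)%:~R * w p.
Proof.
move=> Tb Bc; have wE' : w p = co (ssval p).2 (psi w (map bas (ssval p).1)).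
  by rewrite -[in LHS](PhiK co_bas w) ffunE.
rewrite /coord_op lfunE /= ffunE wE'; case: p {wE'} => -[l m] lm /=.
have := lm; rewrite idxP => /andP[/combsP[_ _ al] mn].
rewrite (act_diag _ Tb (fP w)) // linearB linearZ /= Bc // rmorphB mulrBl.
by [].
Qed.

Lemma adV_bas i : (i < 11)%N -> adV (sl2H F) (bas i) = (wV i)%:~R *: bas i.
Proof.
case: i => [|[|[|i]]] ilt /=; rewrite /adV /= ?linear0 ?scale0r ?linear0 //.
by rewrite v_weight linearZ; congr (_%:~R *: _); rewrite /wV /=; lia.
Qed.

Lemma adS_bas i : (i < 11)%N -> adS (sl2H F) (bas i) = (wS i)%:~R *: bas i.
Proof.
case: i => [|[|[|i]]] ilt /=; rewrite /adS /= /wS /=.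
- by rewrite lie_HE linearMn -scaler_nat.
- by rewrite liexx linear0 scale0r.
- by rewrite lie_HF linearN linearMn -scaler_nat -scaleNr.
- by rewrite !linear0 scale0r.
Qed.

Lemma projV_bas i : (i < 11)%N -> projV (bas i) = (wE i)%:~R *: bas i.
Proof.
case: i => [|[|[|i]]] ilt /=; rewrite /projV /= /wE /=.
- by rewrite linear0 scale0r.
- by rewrite linear0 scale0r.
- by rewrite linear0 scale0r.
- by rewrite scale1r.
Qed.

Lemma diag_co (B : {linear g -> g}) (u : nat -> int) :
    (forall i, (i < 11)%N -> B (bas i) = (u i)%:~R *: bas i) ->
  forall m z, (m < 11)%N -> co m (B z) = (u m)%:~R * co m z.
Proof.
move=> Bb m z mn; rewrite [in LHS](sum_co_bas z) !linear_sum /=.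
rewrite (bigD1 (Ordinal mn)) //= big1 => [|i im].
  by rewrite linearZ /= Bb // linearZ linearZ /= co_bas // eqxx addr0 mulr1 mulrC.
rewrite linearZ /= Bb // linearZ linearZ /= co_bas //.
by rewrite -val_eqE /= in im; rewrite (negPf im) !mulr0.
Qed.

Lemma theta_op_diag k w p :
  theta_op k (sl2H F) w p = (theta_wt (ssval p))%:~R * w p.
Proof.
apply: (coord_op_diag (t := wV) (u := fun m => wV m + wS m)); first exact: adV_bas.
apply: (@diag_co (lie (inS rho (sl2H F))) (fun m => wV m + wS m)).
by move=> i il; rewrite [LHS]lie_inS adS_bas // adV_bas // -scalerDl -rmorphD addrC.
Qed.

Lemma alpha_op_diag k w p :
  alpha_op k (sl2H F) w p = (alpha_wt (ssval p))%:~R * w p.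
Proof.
have -> : alpha_wt (ssval p) = 0 - weight wS (ssval p).1 by rewrite sub0r.
apply: (coord_op_diag (t := wS) (u := fun=> 0)); first exact: adS_bas.
move=> m z _.
by rewrite mul0r linear0.
Qed.

Lemma euler_op_diag k w p : euler_op k w p = (euler_wt (ssval p))%:~R * w p.
Proof.
apply: (coord_op_diag (t := wE) (u := wE)); first exact: projV_bas.
exact: diag_co projV_bas.
Qed.

Lemma lieder_op_diag k w p :
  lieder_op k (sl2H F) w p = (theta_wt (ssval p) + alpha_wt (ssval p))%:~R * w p.
Proof.
by rewrite lieder_opE ffunE theta_op_diag alpha_op_diag -mulrDl -rmorphD.
Qed.

Lemma euler_ced_op k w : euler_op k.+1 (ced_op k w) = ced_op k (euler_op k w).
Proof.
have der (x y : g) : projV (lie x y) = lie (projV x) y + lie x (projV y).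
  case: x y => [x u] [y w'].
  rewrite -[LHS]/(0, rho x w' - rho y u).
  rewrite -[RHS]/(lie 0 y + lie x 0, rho 0 w' - rho y u + (rho x w' - rho 0 u)).
  rewrite !rep0l sub0r subr0 [- _ + _]addrC (linear0 (lie x)).
  by rewrite lieC (linear0 (lie y)) oppr0 addr0.
by apply: Psi_inj; rewrite !PsiE; apply: act_ced.
Qed.

Lemma projV_comm (T : {linear g -> g}) (B : {linear g -> g}) (f : seq g -> g) :
    form f -> (forall z, projV (T z) = T (projV z)) ->
    (forall z, projV (B z) = B (projV z)) ->
  act (@projV _ _ rho) (@projV _ _ rho) (act T B f) =
  act T B (act (@projV _ _ rho) (@projV _ _ rho) f).
Proof.
move=> ff hT hB; apply/eqP; rewrite -subr_eq0; apply/eqP.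
rewrite -[RHS](act0 ff); apply: act_comm => // z; apply/esym/eqP;
  rewrite subr_eq0; apply/eqP.
  exact: hT.
exact: hB.
Qed.

Lemma euler_theta_op k x w :
  euler_op k (theta_op k x w) = theta_op k x (euler_op k w).
Proof.
apply: Psi_inj; rewrite !PsiE; apply: (@projV_comm (adV x) (tau (inS rho x)))
  => // z.
rewrite -[RHS]/(lie (inS rho x) (projV z)) -[X in projV X]/(lie (inS rho x) z).
rewrite /projV !lie_inS /adS /adV /=.
by rewrite !linear0 !add0r.
Qed.

Lemma euler_alpha_op k x w :
  euler_op k (alpha_op k x w) = alpha_op k x (euler_op k w).
Proof.
apply: Psi_inj; rewrite !PsiE; apply: (@projV_comm (adS x) \0) => // z.
rewrite [LHS](linear0 (inV rho)) -[RHS]/(inS rho (lie x 0)).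
by rewrite (linear0 (lie x)) (linear0 (inS rho)).
Qed.

Lemma theta_op_integral_weights k :
  exists ws, integral_weights (theta_op k (sl2H F)) ws.
Proof. by eexists; apply: diag_integral_weights => w i; exact: theta_op_diag. Qed.

Lemma alpha_op_integral_weights k :
  exists ws, integral_weights (alpha_op k (sl2H F)) ws.
Proof. by eexists; apply: diag_integral_weights => w i; exact: alpha_op_diag. Qed.

Lemma lieder_op_integral_weights k :
  exists ws, integral_weights (lieder_op k (sl2H F)) ws.
Proof. by eexists; apply: diag_integral_weights => w i; exact: lieder_op_diag. Qed.

Lemma cas_theta2_inv k (w : W k) :
  cas_theta_op k (cas_theta_op k w) = 0 -> forall x, theta_op k x w = 0.
Proof.
rewrite !cas_theta_opE => OO; have [ws hws] := theta_op_integral_weights k.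
have [e0 f0 h0] := casimir2_ker (theta_op_triple k) hws OO.
exact: (family_invariant (R := theta_op k) (@theta_op_linear k)).
Qed.

Lemma cas_lie2_inv k (w : W k) :
  cas_lie_op k (cas_lie_op k w) = 0 -> forall x, lieder_op k x w = 0.
Proof.
rewrite !cas_lie_opE => OO; have [ws hws] := lieder_op_integral_weights k.
have [e0 f0 h0] := casimir2_ker (lieder_op_triple k) hws OO.
exact: (family_invariant (R := lieder_op k) (@lieder_op_linear k)).
Qed.

Lemma cas_theta_inv k (w : W k) :
  (forall x, theta_op k x w = 0) -> cas_theta_op k w = 0.
Proof. by move=> h; rewrite cas_theta_opE /casimir !h !linear0 !mul0rn !addr0. Qed.

Lemma cas_lie_inv k (w : W k) :
  (forall x, lieder_op k x w = 0) -> cas_lie_op k w = 0.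
Proof. by move=> h; rewrite cas_lie_opE /casimir !h !linear0 !mul0rn !addr0. Qed.

Lemma lker_cas_thetaP k (w : W k) :
  (w \in lker (cas_theta_op k)) <-> (forall x, theta_op k x w = 0).
Proof.
rewrite memv_ker; split=> [/eqP h|/cas_theta_inv ->//].
by apply: cas_theta2_inv; rewrite h linear0.
Qed.

Lemma lker_cas_lieP k (w : W k) :
  (w \in lker (cas_lie_op k)) <-> (forall x, lieder_op k x w = 0).
Proof.
rewrite memv_ker; split=> [/eqP h|/cas_lie_inv ->//].
by apply: cas_lie2_inv; rewrite h linear0.
Qed.

Lemma split_cas_theta k : split_at (cas_theta_op k) fullv.
Proof. by split=> [u _|u _ /cas_theta2_inv /cas_theta_inv //]; exact: memvf. Qed.

Lemma split_cas_lie k : split_at (cas_lie_op k) (lker (cas_theta_op k)).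
Proof.
split=> [u /lker_cas_thetaP Tu|u _ /cas_lie2_inv /cas_lie_inv //];
  apply/lker_cas_thetaP => x.
have TL y w : (forall x, theta_op k x w = 0) ->
    forall x, theta_op k x (lieder_op k y w) = 0.
  move=> Tw z; have := lieder_theta_op y z w; rewrite !Tw linear0 sub0r => /eqP.
  by rewrite oppr_eq0 => /eqP.
have TLL y z := TL y _ (TL z u Tu).
by rewrite cas_lie_opE /casimir !mulr2n !linearD /= !TLL !addr0.
Qed.

Lemma hlie_op_ker k b :
  b \in lker (cas_theta_op k.+1) -> hlie_op k b \in lker (cas_theta_op k).
Proof.
move=> /lker_cas_thetaP Tb; apply/lker_cas_thetaP => y; apply: Psi_inj;
  rewrite !PsiE linear0.
rewrite /hlie cas2_lin (eq_cas2 (b2 := fun _ _ => 0)) ?cas2_0 // => a c /=.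
have T0 x : theta tau x (ins (inS rho c) (psi b)) = 0.
  by rewrite -ins_theta_S // -Psi_theta Tb !linear0.
have fi := form_ins (inS rho c) (fP b).
have := lieder_theta tau a y fi; rewrite !T0 linear0 sub0r => /eqP.
by rewrite oppr_eq0 => /eqP.
Qed.

(** * Counting weights *)

Definition weight_count k (Q : pred (seq nat * nat)) (p q : int) : nat :=
  count (fun i => [&& Q i, alpha_wt i == q & theta_wt i == p]) (idx 11 k).

Definition invariants k : {vspace W k} :=
  (lker (cas_theta_op k) :&: lker (cas_lie_op k))%VS.

Lemma invariantsP k (w : W k) : w \in invariants k <->
  [/\ theta_op k (sl2H F) w = 0, theta_op k (sl2E F) w = 0,
      alpha_op k (sl2H F) w = 0 & alpha_op k (sl2E F) w = 0].
Proof.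
rewrite memv_cap; split.
  move=> /andP[/lker_cas_thetaP T0 /lker_cas_lieP L0].
  have A0 x : alpha_op k x w = 0 by have := L0 x; rewrite lieder_opE T0 add0r.
  by rewrite !T0 !A0.
move=> [Th0 Te0 Ah0 Ae0].
have [ws hws] := theta_op_integral_weights k.
have [ws' hws'] := alpha_op_integral_weights k.
have Tf0 := zero_weight_e_f (theta_op_triple k) hws Th0 Te0.
have Af0 := zero_weight_e_f (alpha_op_triple k) hws' Ah0 Ae0.
have T0 := family_invariant (R := theta_op k) (@theta_op_linear k) Te0 Tf0 Th0.
have A0 := family_invariant (R := alpha_op k) (@alpha_op_linear k) Ae0 Af0 Ah0.
by apply/andP; split; [apply/lker_cas_thetaP|apply/lker_cas_lieP => x;
  rewrite lieder_opE T0 A0 addr0].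
Qed.

Lemma diag_eigenP k (h : 'End(W k)) (lam : seq nat * nat -> int) c w :
    (forall w p, h w p = (lam (ssval p))%:~R * w p) ->
  (w \in eigen h c) = [forall p, (lam (ssval p) != c) ==> (w p == 0)].
Proof.
move=> hE; apply/eigenP/forallP => [hw p|hw].
  apply/implyP => lc; have := congr1 (fun u : W k => u p) hw.
  rewrite hE ffunE => /eqP; rewrite -subr_eq0 -mulrBl -rmorphB mulf_eq0.
  by rewrite intr_eq0 subr_eq0 (negPf lc).
apply/ffunP => p; rewrite hE ffunE; have := hw p.
by have [->|_ /= /eqP ->] := eqVneq (lam (ssval p)) c; rewrite // !mulr0 scaler0.
Qed.

(** For each of the two commuting triples, the invariants have the dimension of
    the weight space 0 minus that of the weight space 2 ([invariant_dim]). The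
    second triple acts on the invariants of the first one. The predicate [Q]
    makes the count possible inside an Euler weight space. *)
Lemma invariant_count k (Q : pred (seq nat * nat)) (S : {vspace W k}) :
    (forall w, (w \in S) = [forall p, ~~ Q (ssval p) ==> (w p == 0)]) ->
    (forall x w, w \in S -> theta_op k x w \in S) ->
    (forall x w, w \in S -> alpha_op k x w \in S) ->
  (\dim (S :&: invariants k) + weight_count k Q 2 0 + weight_count k Q 0 2 =
    weight_count k Q 0 0 + weight_count k Q 2 2)%N.
Proof.
move=> SE ST SA.
have [ws hws] := theta_op_integral_weights k.
have [ws' hws'] := alpha_op_integral_weights k.
pose U q := (S :&: eigen (alpha_op k (sl2H F)) q)%VS.
have memX p q (w : W k) : (w \in (U q :&: eigen (theta_op k (sl2H F)) p)%VS) =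
    [forall i : seq_sub (idx 11 k),
      ~~ [&& Q (ssval i), alpha_wt (ssval i) == q & theta_wt (ssval i) == p]
        ==> (w i == 0)].
  have eA := diag_eigenP q w (@alpha_op_diag k).
  have eT := diag_eigenP p w (@theta_op_diag k).
  rewrite memv_cap eT memv_cap eA SE.
  apply/andP/forallP => [[/andP[/forallP h1 /forallP h2] /forallP h3] i|h].
    apply/implyP; rewrite !negb_and => /or3P[h|h|h].
    - by have := h1 i; rewrite h.
    - by have := h2 i; rewrite h.
    - by have := h3 i; rewrite h.
  split; [apply/andP; split|]; apply/forallP => i; apply/implyP => hi;
    by have := h i; rewrite !negb_and hi ?orbT.
have dimX p q : \dim (U q :&: eigen (theta_op k (sl2H F)) p) = weight_count k Q p q.
  rewrite (dim_support (memX p q)).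
  pose P i := [&& Q i, alpha_wt i == q & theta_wt i == p].
  exact: (card_seq_sub_count P (idx_uniq 11 k)).
have UT q x w : w \in U q -> theta_op k x w \in U q.
  rewrite !memv_cap => /andP[/ST -> /eigenP hw] /=; apply/eigenP.
  by rewrite -theta_alpha_op hw linearZ.
have i1 q := invariant_dim (theta_op_triple k) hws (UT q (sl2E F)) (UT q (sl2F F)).
pose I := (S :&: eigen (theta_op k (sl2H F)) 0 :&: lker (theta_op k (sl2E F)))%VS.
have IA x w : w \in I -> alpha_op k x w \in I.
  rewrite !memv_cap => /andP[/andP[/SA -> /eigenP hw] ew].
  have {}ew : theta_op k (sl2E F) w = 0 by apply/eqP; rewrite -memv_ker.
  apply/andP; split.
    by apply/eigenP; rewrite theta_alpha_op hw linearZ.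
  by rewrite memv_ker theta_alpha_op ew linear0.
have i2 := invariant_dim (alpha_op_triple k) hws' (IA (sl2E F)) (IA (sl2F F)).
have IU q : (I :&: eigen (alpha_op k (sl2H F)) q)%VS =
    (U q :&: eigen (theta_op k (sl2H F)) 0 :&: lker (theta_op k (sl2E F)))%VS.
  exact: capv_rot.
have capP := @memv_capP F (W k).
have JE : (S :&: invariants k =
    I :&: eigen (alpha_op k (sl2H F)) 0 :&: lker (alpha_op k (sl2E F)))%VS.
  apply/vspaceP => w; apply/idP/idP.
    move=> /capP[wS /invariantsP[a b c d]]; apply/capP; split;
      last by rewrite memv_ker d.
    apply/capP; split; last by apply/eigenP; rewrite scale0r.
    apply/capP; split; last by rewrite memv_ker b.
    by apply/capP; split=> //; apply/eigenP; rewrite scale0r.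
  move=> /capP[/capP[/capP[/capP[wS /eigenP a] b] /eigenP c] d].
  apply/capP; split=> //; apply/invariantsP; rewrite a c !scale0r; split=> //.
    by apply/eqP; rewrite -memv_ker.
  by apply/eqP; rewrite -memv_ker.
pose dimv (X : {vspace W k}) := \dim X.
have arith a d c e0 e2 j x20 x00 x22 x02 :
    (a + d = c -> j = a -> c = e0 -> d = e2 ->
     e0 + x20 = x00 -> e2 + x22 = x02 -> j + x20 + x02 = x00 + x22)%N by lia.
rewrite -!dimX.
apply: arith i2 (congr1 dimv JE) (congr1 dimv (IU 0)) (congr1 dimv (IU 2)) _ _.
  exact: i1.
exact: i1.
Qed.

Definition nonzero_degrees : seq nat := [:: 1; 3; 4; 5; 6; 7; 8; 10]%N.

(** The invariants of odd degree [k] have [k] arguments in [V] and values in [V];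
    those of even degree [k] have three arguments in [sl2] and [k - 3] arguments
    in [V]. *)
Definition invariant_euler_wt (k : nat) : int :=
  if odd k then 1 - k%:Z else 4 - k%:Z.

Lemma weight_count_table k :
  (weight_count k predT 0 0 + weight_count k predT 2 2 =
   (k \in nonzero_degrees) + weight_count k predT 2 0 + weight_count k predT 0 2)%N.
Proof.
have [kb|kb] := ltnP k 12; last first.
  (* The exterior powers of [g] vanish above degree 11. *)
  rewrite /weight_count /idx combs_big //= !addn0.
  by case: k kb => [|[|[|[|[|[|[|[|[|[|[|[|k]]]]]]]]]]]].
have : all (fun k => weight_count k predT 0 0 + weight_count k predT 2 2 ==
    (k \in nonzero_degrees) + weight_count k predT 2 0
      + weight_count k predT 0 2)%N (iota 0 12) by vm_compute.
by move/allP/(_ k); rewrite mem_iota => /(_ kb) /eqP.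
Qed.

Lemma weight_count_euler_table k : k \in nonzero_degrees ->
  let Q := fun i => euler_wt i == invariant_euler_wt k in
  (weight_count k Q 0 0 + weight_count k Q 2 2 =
   1 + weight_count k Q 2 0 + weight_count k Q 0 2)%N.
Proof.
have : all (fun k => let Q := fun i => euler_wt i == invariant_euler_wt k in
    weight_count k Q 0 0 + weight_count k Q 2 2 ==
    1 + weight_count k Q 2 0 + weight_count k Q 0 2)%N nonzero_degrees
  by vm_compute.
by move/allP/(_ k) => h /h /eqP.
Qed.

Lemma dim_invariants k : \dim (invariants k) = (k \in nonzero_degrees).
Proof.
have := @invariant_count k predT fullv; rewrite capfv weight_count_table => h.
set m20 := weight_count _ _ 2 0 in h; set m02 := weight_count _ _ 0 2 in h.
suff : (\dim (invariants k) + m20 + m02 =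
  (k \in nonzero_degrees) + m20 + m02)%N by lia.
by apply: h => // [w|x w _|x w _]; rewrite ?memvf //; apply/esym/forallP.
Qed.

(** Inside the Euler weight space [S] the count gives the same dimension, so
    this space contains all the invariants. *)
Lemma euler_invariants k (w : W k) :
  w \in invariants k -> euler_op k w = (invariant_euler_wt k)%:~R *: w.
Proof.
move=> wJ; have [kd|kd] := boolP (k \in nonzero_degrees); last first.
  have J0 : invariants k = 0%VS by apply/eqP;
    rewrite -dimv_eq0 dim_invariants (negPf kd).
  by move: wJ; rewrite J0 memv0 => /eqP ->; rewrite linear0 scaler0.
apply/eigenP; set S := eigen _ _.
have dS : \dim (S :&: invariants k) = 1%N.
  have := @invariant_count k (fun i => euler_wt i == invariant_euler_wt k) S.
  rewrite (weight_count_euler_table kd) => h.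
  set m20 := weight_count _ _ 2 0 in h; set m02 := weight_count _ _ 0 2 in h.
  suff : (\dim (S :&: invariants k) + m20 + m02 = 1 + m20 + m02)%N by lia.
  apply: h => [u|x u /eigenP hu|x u /eigenP hu].
  - exact: (diag_eigenP _ _ (@euler_op_diag k)).
  - by apply/eigenP; rewrite euler_theta_op hu linearZ.
  - by apply/eigenP; rewrite euler_alpha_op hu linearZ.
have SJ : (S :&: invariants k = invariants k)%VS.
  by apply/eqP; rewrite -dimv_leqif_eq ?capvSr // dS dim_invariants kd.
by move: wJ; rewrite -SJ memv_cap => /andP[].
Qed.

(** The differential preserves the invariants and their Euler weight, and the
    nonzero invariants in degrees [k] and [k.+1] have different Euler
    weights. *)
Lemma ced_op_invariants k (w : W k) : w \in invariants k -> ced_op k w = 0.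
Proof.
move=> wJ.
have DJ : ced_op k w \in invariants k.+1.
  move: wJ; rewrite !memv_cap !memv_ker cas_theta_ced_op cas_lie_ced_op =>
    /andP[/eqP -> /eqP ->].
  by rewrite !linear0 eqxx.
have := euler_invariants DJ; rewrite euler_ced_op (euler_invariants wJ) linearZ
  /= => /eqP.
rewrite -subr_eq0 -scalerBl -rmorphB scaler_eq0 intr_eq0 subr_eq0.
case/orP => [|/eqP //].
have zero m (u : W m) : m \notin nonzero_degrees -> u \in invariants m -> u = 0.
  move=> md; have -> : invariants m = 0%VS by apply/eqP;
    rewrite -dimv_eq0 dim_invariants (negPf md).
  by rewrite memv0 => /eqP.
have [kd|kd] := boolP (k \in nonzero_degrees);
  last by rewrite (zero _ _ kd wJ) linear0.
have [kd'|kd'] := boolP (k.+1 \in nonzero_degrees);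
  last by rewrite (zero _ _ kd' DJ).
have : all (fun m => (m.+1 \in nonzero_degrees) ==>
    (invariant_euler_wt m != invariant_euler_wt m.+1)) nonzero_degrees
  by vm_compute.
by move/allP/(_ k kd); rewrite kd' /= => /negPf ->.
Qed.

Definition coboundaries k : {vspace W k} :=
  match k return {vspace W k} with 0 => 0%VS | k'.+1 => limg (ced_op k') end.

Lemma cohomology_dim k :
  (coboundaries k <= lker (ced_op k))%VS /\
  \dim (lker (ced_op k)) = (\dim (coboundaries k) + (k \in nonzero_degrees))%N.
Proof.
rewrite -dim_invariants; case: k => [|k].
  (* There is nothing in degree -1: the zero maps on [W 0] play this part. *)
  have s0 (U : {vspace W 0}) : split_at (0%VF : 'End(W 0)) U.
    by split=> u _; rewrite !zero_lfunE ?mem0v.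
  have := @two_step_dim F (W 0) (W 0) (W 1) 0%VF (ced_op 0) _ 0%VF 0%VF
    (cas_theta_op 0) (cas_lie_op 0) (cas_theta_op 1) (cas_lie_op 1)
    0%VF 0%VF (htheta_op 0) (hlie_op 0).
  rewrite lim0g; apply; try exact: split_cas_theta; try exact: split_cas_lie;
    try exact: s0; try (by move=> a; rewrite !zero_lfunE ?linear0);
    try exact: cas_theta_ced_op; try exact: cas_lie_ced_op.
  - by move=> b _; rewrite zero_lfunE mem0v.
  - by move=> b; rewrite zero_lfunE add0r htheta_ced_op0.
  - by move=> b; rewrite zero_lfunE add0r hlie_ced_op0.
  - by move=> b Ob Pb; apply/ced_op_invariants/memv_capP; split;
    rewrite memv_ker ?Ob ?Pb.
have DJ m (b : W m) : cas_theta_op m b = 0 -> cas_lie_op m b = 0 -> ced_op m b = 0.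
  by move=> Ob Pb; apply/ced_op_invariants/memv_capP; split;
    rewrite memv_ker ?Ob ?Pb.
apply: (two_step_dim (@ced_op_ced_op k)
  (@split_cas_theta _) (@split_cas_theta _) (@split_cas_theta _)
  (@split_cas_lie _) (@split_cas_lie _) (@split_cas_lie _)
  (@hlie_op_ker k) (@ced_htheta_op k) (@ced_hlie_op k)
  (@cas_theta_ced_op k) (@cas_theta_ced_op k.+1)
  (@cas_lie_ced_op k) (@cas_lie_ced_op k.+1) (@DJ k) (@DJ k.+1)).
Qed.

(** * From cochains to coordinates *)

Definition zeta k (f : ('I_k -> g) -> g) : W k := phi k (to_form f).

Lemma form_cochain k (f : cochain g g k) : form (to_form f).
Proof.
have := cochainP f; rewrite inE => /asboolP[fl fa].
exact: form_to_form.
Qed.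

Lemma to_form_inj k : injective (@to_form F g g k).
Proof.
move=> f f' E; apply/funext => x.
have := congr1 (fun u : seq g -> g => u [seq x i | i <- enum 'I_k]) E.
rewrite /to_form size_map size_enum_ord eqxx.
have -> // : (fun i : 'I_k => [seq x i | i <- enum 'I_k]`_i) = x.
apply/funext => i; rewrite (nth_map i) ?size_enum_ord //.
by rewrite nth_ord_enum.
Qed.

Lemma to_form_ce_diff k (f : cochain g g k) :
  to_form (ce_diff tau f) = ced tau (to_form f).
Proof.
have := cochainP f; rewrite inE => /asboolP[fl fa].
apply/funext => s; rewrite {1}/to_form; case: eqP => [sk|/eqP sk].
  exact: ce_diffE.
by rewrite (homog_ced tau (homog_to_form f)).
Qed.

Lemma psi_zeta k (f : cochain g g k) : psi (zeta f) = to_form f.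
Proof.
exact: (PsiK co_bas sum_co_bas (form_cochain f) (homog_to_form f)).
Qed.

Lemma ced_op_zeta k (f : cochain g g k) : ced_op k (zeta f) = zeta (ce_diff tau f).
Proof.
apply: Psi_inj; rewrite !PsiE psi_zeta /zeta to_form_ce_diff; apply/esym.
apply: (PsiK co_bas sum_co_bas); first exact/form_ced/form_cochain.
exact/homog_ced/homog_to_form.
Qed.

Lemma det_is_cochain k (w : W k) : det_cochain bas co w \in @is_cochain F g g k.
Proof.
rewrite inE; apply/asboolP; split.
  exact: det_cochain_multilinear.
exact: det_cochain_alternating.
Qed.

Definition cochain_of k (w : W k) : cochain g g k := Cochain (det_is_cochain w).

Lemma zeta_cochain_of k (w : W k) : zeta (cochain_of w) = w.
Proof. exact: (PhiK co_bas). Qed.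

Lemma cocycleE k (f : cochain g g k) :
  (f \in @is_cocycle F g g tau k) = (zeta f \in lker (ced_op k)).
Proof.
rewrite memv_ker ced_op_zeta inE; apply/eqP/eqP => [->|f0];
  first by rewrite /zeta linear0 linear0.
apply: to_form_inj; rewrite linear0 to_form_ce_diff -psi_zeta -Psi_ced
  ced_op_zeta f0.
exact: linear0.
Qed.

Lemma coboundaryE k (z : cocycle tau k) :
  (z \in @is_coboundary F g g tau k) = (zeta z \in coboundaries k).
Proof.
case: k z => [|k] z.
  rewrite [LHS]inE memv0; apply/eqP/eqP => [->|z0].
    by rewrite /zeta -[X in to_form X]/(0 : ('I_0 -> g) -> g) !linear0.
  apply/val_inj/val_inj; apply: to_form_inj; rewrite -psi_zeta z0 linear0.
  by rewrite -[X in to_form X]/(0 : ('I_0 -> g) -> g) linear0.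
rewrite [LHS]inE; apply/asboolP/idP => [[f zf]|/memv_imgP[w _ zw]].
  by rewrite zf -ced_op_zeta memv_img // memvf.
exists (cochain_of w); apply: to_form_inj.
by rewrite to_form_ce_diff -!psi_zeta zeta_cochain_of zw Psi_ced.
Qed.

Lemma zeta_linear k : linear (@zeta k).
Proof. by move=> a f f'; rewrite /zeta !linearP. Qed.

Lemma lift_cocycle k (w : W k) : w \in lker (ced_op k) ->
  exists z : cocycle tau k, zeta z = w.
Proof.
move=> wD; have wz : cochain_of w \in @is_cocycle F g g tau k.
  by rewrite cocycleE zeta_cochain_of.
by exists (Cocycle wz); rewrite zeta_cochain_of.
Qed.

Lemma cohomology_adjoint k :
  (k \in nonzero_degrees -> lmod_iso (cohomology tau k) F^o) /\
  (k \notin nonzero_degrees -> forall c : cohomology tau k, c = 0).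
Proof.
have [BZ dZ] := cohomology_dim k.
have zD (z : cocycle tau k) : zeta z \in lker (ced_op k) by rewrite -cocycleE
  cocycleP.
split=> kd; last first.
  have BE : coboundaries k = lker (ced_op k).
    by apply/eqP; rewrite -dimv_leqif_eq // dZ (negPf kd) addn0.
  elim/quotW=> z; apply: quot_mod_eq0.
  by rewrite coboundaryE BE.
have [u uZ uB] : exists2 u, u \in lker (ced_op k) & u \notin coboundaries k.
  apply/subvPn; apply/negP => ZB; have := dimvS ZB.
  by rewrite dZ kd addn1 ltnn.
have ZE : lker (ced_op k) = (coboundaries k + <[u]>)%VS.
  apply/esym/eqP; rewrite -dimv_leqif_eq; last by rewrite subv_add BZ -memvE.
  rewrite dimv_disjoint_sum.
    rewrite dZ kd dim_vline; have [u0|//] := eqVneq u 0.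
    by rewrite u0 mem0v in uB.
  apply/eqP; rewrite -subv0; apply/subvP => x; rewrite memv_cap memv0.
  move=> /andP[xB /vlineP[a xE]]; rewrite xE; apply: contraNT uB.
  rewrite scaler_eq0 negb_or => /andP[a0 _].
  by rewrite -[u](scalerK a0) -xE memvZ.
have [z zu] := lift_cocycle uZ.
apply: (@quot_mod_line _ _ _ z); first by rewrite coboundaryE zu.
move=> y; have := zD y; rewrite ZE => /memv_addP[x xB [_ /vlineP[a ->] yE]].
exists a; rewrite coboundaryE.
have -> : zeta (y - a *: z) = zeta y - a *: zeta z.
  have -> : (y - a *: z : cocycle tau k) = (- a) *: z + y :> (('I_k -> g) -> g).
    by rewrite addrC scaleNr.
  by rewrite zeta_linear scaleNr addrC.
by rewrite yE zu addrK.
Qed.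

End Operators.

Theorem proposition4p5 (R : realType)
  (V7 : vectType R[i]) (rho : lieRep (sl2 R[i]) V7)
  (V7_irr : irreducible_rep rho) (V7_dim : \dim (fullv : {vspace V7}) = 8%N)
  (k : nat) :
  let g : lieAlgType R[i] := semidirect rho in
  (k \in [:: 1; 3; 4; 5; 6; 7; 8; 10]%N ->
     lmod_iso (cohomology (adjoint g) k) R[i]^o)
  /\ (k \notin [:: 1; 3; 4; 5; 6; 7; 8; 10]%N ->
     forall c : cohomology (adjoint g) k, c = 0).
Proof.
have [v [cv [cv_v sum_cv v_weight]]] := irreducible_weight_basis V7_irr V7_dim.
exact: (cohomology_adjoint cv_v sum_cv v_weight k).
Qed.
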